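(* Every Dutch windmill with at most three pendant triangles is graceful or near graceful. That is, let $G$ be a graph obtained from a Dutch windmill (with any number, at least one, of vanes) by successively adding at most three pendant triangles. Then $G$ is graceful or near graceful.
   Context: All graphs are finite and simple. A triangular cactus is a connected graph whose blocks are all triangles ($K_3$). A Dutch windmill is a triangular cactus all of whose blocks share a common vertex (the central vertex); its blocks are called vanes. A pendant triangle is a block (a triangle) added to a triangular cactus: one adds two new vertices $y,z$ and the three edges of a triangle on $\{v,y,z\}$, where $v$ is a vertex already present in the cactus. Pendant triangles may be attached to vanes or to previously added pendant triangles, at any of their vertices, and several may be attached at the same vertex. (A triangle attached at the central vertex simply gives another vane.) Let $G=(V,E)$ be a graph with $m$ edges. For a vertex labelling $f$, the induced edge labelling is $g(uv)=|f(u)-f(v)|$ for $uv\in E$. A graceful labelling of $G$ is an injection $f:V\to\{0,1,\dots,m\}$ such that $g$ is a bijection from $E$ onto $\{1,2,\dots,m\}$. $G$ is graceful if it has a graceful labelling. A near graceful labelling of $G$ is an injection $f:V\to\{0,1,\dots,m+1\}$ such that $g$ is a bijection from $E$ onto $\{1,2,\dots,m-1,m\}$ or onto $\{1,2,\dots,m-1,m+1\}$. $G$ is near graceful if it has a near graceful labelling. *)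

(* Defs.v *)
From HB Require Import structures.
From mathcomp Require Import all_boot all_order all_algebra.

Set Implicit Arguments.
Unset Strict Implicit.
Unset Printing Implicit Defensive.

Record sgraph := SGraph {
  vertex :> finType;
  adj : rel vertex;
  adj_sym : symmetric adj;
  adj_irrefl : irreflexive adj }.

Definition isomorphic (G H : sgraph) : Prop :=
  exists2 h : G -> H, bijective h & forall x y, adj (h x) (h y) = adj x y.

Section Blocks.

Variable G : sgraph.
Implicit Types (u v x y : G) (A B : {set G}).

Definition edges : {set {set G}} :=
  [set [set p.1; p.2] | p : G * G & adj p.1 p.2].

Definition adj_in A : rel G :=
  [rel x y | [&& x \in A, y \in A & adj x y]].

(* Any two vertices of A are joined by a path inside A; the empty set is
   allowed here, so that deleting the only vertex of a one-vertex graph does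
   not count as disconnecting it. *)
Definition joined_in A : bool :=
  [forall x in A, forall y in A, connect (adj_in A) x y].

Definition connected_graph : bool :=
  ([set: G] != set0) && joined_in [set: G].

(* The subgraph induced on B is non-null, connected and has no cut vertex. *)
Definition nonseparable B : bool :=
  [&& B != set0, joined_in B & [forall v in B, joined_in (B :\ v)]].

(* A block is a maximal connected subgraph without a cut vertex. Maximality
   makes it an induced subgraph, so it is given by its vertex set. *)
Definition block B : bool := maxset nonseparable B.

Definition triangle B : bool :=
  (#|B| == 3) && [forall x in B, forall y in B, (x != y) ==> adj x y].

Definition triangular_cactus : Prop :=
  connected_graph /\ forall B, block B -> triangle B.

(* There is at least one vane: a connected graph is non-null, hence has a
   block (the one-vertex graph is its own block, so it is not a cactus). *)
Definition dutch_windmill : Prop :=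
  triangular_cactus /\ exists c : G, forall B, block B -> c \in B.

End Blocks.

Section PendantTriangle.

Variables (G : sgraph) (v : G).

(* The new vertices are inr false and inr true. *)
Definition pendant_adj : rel (G + bool) := fun x y =>
  match x, y with
  | inl a, inl b => adj a b
  | inl a, inr _ => a == v
  | inr _, inl b => b == v
  | inr i, inr j => i != j
  end.

Lemma pendant_adj_sym : symmetric pendant_adj.
Proof. by case=> [a|i] [b|j] //=; [apply: adj_sym | rewrite eq_sym]. Qed.

Lemma pendant_adj_irrefl : irreflexive pendant_adj.
Proof. by case=> [a|i] /=; [apply: adj_irrefl | rewrite eqxx]. Qed.

Definition add_pendant : sgraph := SGraph pendant_adj_sym pendant_adj_irrefl.

End PendantTriangle.

Inductive with_pendants (W : sgraph) : nat -> sgraph -> Prop :=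
| with_pendants0 : with_pendants W 0 W
| with_pendantsS n (H K : sgraph) (v : H) :
    with_pendants W n H -> isomorphic (add_pendant v) K ->
    with_pendants W n.+1 K.

Section Labellings.

Variable G : sgraph.
Implicit Types (f : G -> nat) (L : pred nat).

Definition edge_label f (u v : G) : nat := `|f u - f v|%N.

(* The edge labelling induced by f is a bijection from the edges, as unordered
   pairs of adjacent vertices, onto L. *)
Definition edge_label_bij f L : Prop :=
  [/\ forall u v, adj u v -> L (edge_label f u v),
      forall u v x y, adj u v -> adj x y ->
        edge_label f u v = edge_label f x y -> [set u; v] = [set x; y]
    & forall k, L k -> exists u v, adj u v /\ edge_label f u v = k].

Definition graceful_labelling f : Prop :=
  let m := #|edges G| in
  [/\ injective f, forall v, f v <= m &
      edge_label_bij f (fun k => 1 <= k <= m)].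

Definition near_graceful_labelling f : Prop :=
  let m := #|edges G| in
  [/\ injective f, forall v, f v <= m.+1 &
      edge_label_bij f (fun k => 1 <= k <= m) \/
      edge_label_bij f (fun k => (1 <= k <= m.-1) || (k == m.+1))].

Definition graceful : Prop := exists f, graceful_labelling f.

Definition near_graceful : Prop := exists f, near_graceful_labelling f.

End Labellings.

(* Main.v *)
Require Import Defs.
From mathcomp Require Import all_boot all_order all_algebra.
From mathcomp Require Import zify.

Set Implicit Arguments.
Unset Strict Implicit.
Unset Printing Implicit Defensive.

(** Let N be the number of triangles, so that there are 3N edges. The central
vertex is labelled 0. A plain vane, one whose two outer vertices carry no
further triangle, may then be labelled {0, u, v} and uses up the edge labels
u, v and v - u.

A Langford sequence of defect 7 and length l splits the positions 1, ..., 2l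
into l pairs at the distances 7, ..., l + 6. Adding l + 6 to all positions
turns its pairs into l vanes whose edge labels are 7, ..., 3l + 6. Only the
labels 1, ..., 6 and the twelve largest ones are left, and they have to be used
by six triangles: those which carry the pendants, the pendants themselves, and
vanes that fill up the number; three pendants never need more than six. Label
the vertices of these six triangles (a gadget) by numbers that are either small,
a <= 12, or close to the maximal label M, say M - b with b <= 12. Two small or
two large vertices give the edge label |a - a'|, a small and a large one give
M - (a + b). So it is enough that the differences run through 1, ..., 6 and
that the sums run through twelve prescribed numbers, those by which the missing
large labels fall short of M. This condition does not involve l, hence is a
finite search for each shape of the gadget. There are 17 shapes (cactus_codes),
because the pendants are at most three; cactus_codes_complete shows that no
graph escapes them.

The edge labels of a triangle have an even sum, so the sum of all edge labels is
even. This leaves graceful labellings when N = 0, 1 mod 4 and near graceful ones,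
with the edge labels 1, ..., 3N - 1, 3N + 1, when N = 2, 3 mod 4. In terms of l = N - 6, Langford sequences exist for
l = 0, 1 mod 4, which is the near graceful case. For l = 2, 3 mod 4 there are
hooked ones, with the positions 1, ..., 2l - 1, 2l + 1, and the gadget takes over
the edge label that the hole leaves out (large_graceful).

Langford sequences of defect 7 need l >= 13. For l >= 44 there is an
explicit family for each residue of l mod 4; the shorter ones are listed one by
one (langford7). The finitely many graphs with N <= 18 are labelled one by one
(small_graceful). *)

(** * Graphs described by lists of triangles *)

Definition tri_map (A B : Type) (f : A -> B) (t : A * A * A) : B * B * B :=
  (f t.1.1, f t.1.2, f t.2).

Definition tri_sides (A : Type) (t : A * A * A) : seq (A * A) :=
  [:: (t.1.1, t.1.2); (t.1.1, t.2); (t.1.2, t.2)].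

Definition sides (A : Type) (T : seq (A * A * A)) : seq (A * A) :=
  flatten (map (@tri_sides A) T).

Definition unpair (A : Type) (ps : seq (A * A)) : seq A :=
  flatten [seq [:: p.1; p.2] | p <- ps].

Definition pair_map (A B : Type) (f : A -> B) (p : A * A) : B * B :=
  (f p.1, f p.2).

Definition linked (A : eqType) (E : seq (A * A)) (x y : A) : bool :=
  ((x, y) \in E) || ((y, x) \in E).

Lemma size_sides (A : Type) (T : seq (A * A * A)) : size (sides T) = 3 * size T.
Proof. by elim: T => //= t T IH; rewrite IH; lia. Qed.

Lemma size_unpair (A : Type) (ps : seq (A * A)) : size (unpair ps) = 2 * size ps.
Proof. by elim: ps => //= p ps IH; rewrite IH; lia. Qed.

Lemma unpair_cat (A : Type) (ps qs : seq (A * A)) :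
  unpair (ps ++ qs) = unpair ps ++ unpair qs.
Proof. by rewrite /unpair map_cat flatten_cat. Qed.

Lemma map_unpair (A B : Type) (f : A -> B) ps :
  map f (unpair ps) = unpair (map (pair_map f) ps).
Proof. by elim: ps => //= p ps ->. Qed.

Lemma map_sides (A B : Type) (f : A -> B) T :
  map (pair_map f) (sides T) = sides (map (tri_map f) T).
Proof. by elim: T => //= t T ->. Qed.

Lemma sides_cat (A : Type) (S T : seq (A * A * A)) :
  sides (S ++ T) = sides S ++ sides T.
Proof. by rewrite /sides map_cat flatten_cat. Qed.

Lemma mem_unpair (A : eqType) (ps : seq (A * A)) x :
  (x \in unpair ps) = has (fun p => (x == p.1) || (x == p.2)) ps.
Proof. by elim: ps => //= p ps IH; rewrite !inE IH orbA. Qed.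

Lemma linked_sides (A : eqType) (T : seq (A * A * A)) x y :
  linked (sides T) x y = has (fun t => linked (tri_sides t) x y) T.
Proof.
elim: T => //= t T IH; rewrite -IH /linked /sides /= !inE.
by rewrite -!orbA; do !bool_congr; rewrite orbC -!orbA; do !bool_congr.
Qed.

(** V is kept as a list because the codes below refer to the vertices by their
places in it. *)
Definition triangulated (G : sgraph) (V : seq G) (T : seq (G * G * G)) : Prop :=
  [/\ uniq V, forall x, x \in V & forall x y, adj x y = linked (sides T) x y].

Lemma eq_triangulated (G : sgraph) (V V' : seq G) (T T' : seq (G * G * G)) :
  perm_eq V V' ->
  (forall x y, linked (sides T) x y = linked (sides T') x y) ->
  triangulated V T -> triangulated V' T'.
Proof.
move=> pV eT [uV aV adjT]; split; first by rewrite -(perm_uniq pV).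
  by move=> x; rewrite -(perm_mem pV).
by move=> x y; rewrite adjT.
Qed.

Lemma linked_map (A B : eqType) (f : A -> B) (T : seq (A * A * A)) x y :
  injective f ->
  linked (sides (map (tri_map f) T)) (f x) (f y) = linked (sides T) x y.
Proof.
move=> f_inj; rewrite -map_sides /linked.
have pI : injective (pair_map f) by move=> [a b] [c d] [/f_inj-> /f_inj->].
by rewrite -[(f x, f y)]/(pair_map f (x, y)) -[(f y, f x)]/(pair_map f (y, x))
  !mem_map.
Qed.

Lemma linked_in (A : eqType) (T : seq (A * A * A)) x y :
  linked (sides T) x y ->
  has (fun t => (x \in [:: t.1.1; t.1.2; t.2]) && (y \in [:: t.1.1; t.1.2; t.2])) T.
Proof.
rewrite linked_sides; apply: sub_has => -[[a b] c] /=.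
rewrite /linked /tri_sides !inE !xpair_eqE /=.
by case/orP=> /or3P[] /andP[/eqP-> /eqP->]; rewrite !eqxx ?orbT.
Qed.

Lemma triangulated_pendant (H K : sgraph) (v : H) (V : seq H) T
    (h : add_pendant v -> K) :
  bijective h -> (forall x y, adj (h x) (h y) = adj x y) ->
  triangulated V T ->
  triangulated (map (h \o inl) V ++ [:: h (inr false); h (inr true)])
    (rcons (map (tri_map (h \o inl)) T) (h (inl v), h (inr false), h (inr true))).
Proof.
move=> h_bij h_adj [uV aV adjT]; have h_inj := bij_inj h_bij.
have f_inj : injective (h \o (inl : H -> add_pendant v)).
  by move=> x y /h_inj[].
set f := h \o _ in f_inj *; set T' := rcons _ _.
have old w b : (h (inr b) \in [:: f w.1.1; f w.1.2; f w.2]) = false.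
  by apply/negP; rewrite !inE => /or3P[] /eqP /h_inj.
split.
- rewrite cat_uniq map_inj_uniq // uV /= !inE.
  rewrite (inj_eq h_inj) /= andbT orbF; apply/norP; split;
    by apply/mapP => -[x _ /h_inj].
- move=> y; case: h_bij => g _ hK; rewrite -(hK y) mem_cat.
  case: (g y) => [x|[]]; rewrite ?inE ?eqxx ?orbT //.
  by apply/orP; left; apply: (map_f f).
move=> x y; case: h_bij => g _ hK; rewrite -(hK x) -(hK y) h_adj.
have lT' a b : linked (sides T') a b =
    linked (sides (map (tri_map f) T)) a b
    || linked (tri_sides (f v, h (inr false), h (inr true))) a b.
  by rewrite !linked_sides /T' has_rcons orbC.
rewrite lT'.
have noT b z : linked (sides (map (tri_map f) T)) (h (inr b)) z = false.
  by apply/negP => /linked_in /hasP[t /mapP[w _ ->]] /=; rewrite old.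
have linkC a b E : @linked K E a b = linked E b a by rewrite /linked orbC.
have last a b : linked (tri_sides (f v, h (inr false), h (inr true))) (h a) (h b)
    = linked (tri_sides ((inl v : add_pendant v), inr false, inr true)) a b.
  rewrite /linked /tri_sides /= !inE !xpair_eqE.
  by rewrite -[f v]/(h (inl v)) !(inj_eq h_inj).
rewrite last.
case: (g x) (g y) => [a|i] [b|j] /=.
- rewrite -[h (inl a)]/(f a) -[h (inl b)]/(f b) linked_map // -adjT /linked /=.
  rewrite !inE !xpair_eqE /= !andbF !orbF.
  have e (p q : H) (r : bool) :
    ((inl p : H + bool) == inr r) = false by [].
  by rewrite ?e /= ?andbF ?orbF.
- rewrite linkC noT /linked /= !inE !xpair_eqE /=.
  by case: j; rewrite /eq_op /= ?andbF ?andbT ?orbF.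
- rewrite noT /linked /= !inE !xpair_eqE /=.
  by case: i; rewrite /eq_op /= ?andbF ?andbT ?orbF.
- rewrite noT /linked /= !inE !xpair_eqE /=.
  by case: i; case: j.
Qed.

(** * Windmills *)

Lemma universal_joined_in (G : sgraph) (A : {set G}) u :
  u \in A -> {in A, forall w, w != u -> adj u w} -> joined_in A.
Proof.
move=> uA uadj.
have step w : w \in A -> connect (adj_in A) u w.
  move=> wA; have [->|wu] := eqVneq w u; first exact: connect0.
  by apply: connect1; rewrite /adj_in /= uA wA uadj.
have step' w : w \in A -> connect (adj_in A) w u.
  move=> wA; have [->|wu] := eqVneq w u; first exact: connect0.
  by apply: connect1; rewrite /adj_in /= uA wA adj_sym uadj.
apply/forall_inP => x xA; apply/forall_inP => y yA.
exact: connect_trans (step' x xA) (step y yA).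
Qed.

(** Whichever vertex is deleted, one of the two dominating vertices survives and
keeps the rest together. *)
Lemma two_universal_nonseparable (G : sgraph) (A : {set G}) u v :
  u != v -> u \in A -> v \in A ->
  {in A, forall w, w != u -> adj u w} -> {in A, forall w, w != v -> adj v w} ->
  nonseparable A.
Proof.
move=> uv uA vA uadj vadj; apply/and3P; split.
- by apply/set0Pn; exists u.
- exact: universal_joined_in uA uadj.
apply/forall_inP => x xA; have [xu|xu] := eqVneq x u.
  apply: (@universal_joined_in _ _ v); first by rewrite !inE xu eq_sym uv.
  by move=> w; rewrite !inE => /andP[_]; apply: vadj.
apply: (@universal_joined_in _ _ u); first by rewrite !inE eq_sym xu.
by move=> w; rewrite !inE => /andP[_]; apply: uadj.
Qed.

Lemma nonseparable1 (G : sgraph) (x : G) : nonseparable [set x].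
Proof.
apply/and3P; split; first by apply/set0Pn; exists x; rewrite inE.
  apply: (@universal_joined_in _ _ x); first by rewrite inE.
  by move=> w; rewrite inE => ->.
apply/forall_inP => v; rewrite inE => /eqP->; rewrite setDv.
by apply/forall_inP => y; rewrite inE.
Qed.

(** Edges xy and xz away from the centre c, with y and z distinct, are
impossible: c and x dominate the four vertices c, x, y, z, which would then lie
in one block, but blocks have only three vertices. The rest holds because every
vertex lies in a block through c. *)
Lemma windmill_mate (W : sgraph) (c : W) :
  (forall B : {set W}, block B -> triangle B) ->
  (forall B : {set W}, block B -> c \in B) ->
  [/\ forall x, x != c -> adj c x,
      forall x, x != c -> exists2 y, y != c & adj x y
    & forall x y z, x != c -> y != c -> z != c ->
        adj x y -> adj x z -> y = z].
Proof.
move=> tri cB.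
have blk A : nonseparable A -> exists2 B : {set W}, A \subset B &
    [/\ c \in B, #|B| = 3 & {in B &, forall x y, x != y -> adj x y}].
  move=> nA; have [B bB AB] := maxset_exists nA; exists B => //.
  have /andP[/eqP B3 /forall_inP adjB] := tri _ bB; split; [exact: cB | by [] |].
  by move=> x y xB yB xy; have /forall_inP/(_ y yB)/implyP := adjB x xB; apply.
have hub x : x != c -> adj c x.
  move=> xc; have [B xB [cinB _ adjB]] := blk _ (nonseparable1 x).
  by apply: adjB; rewrite // ?(subsetP xB) ?inE // eq_sym.
split=> // [x xc | x y z xc yc zc xy xz].
  have [B xB [cinB B3 adjB]] := blk _ (nonseparable1 x).
  rewrite sub1set in xB.
  have: 0 < #|B :\ c :\ x|.
    have := cardsD1 c B; have := cardsD1 x (B :\ c).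
    by rewrite !inE cinB xB xc B3; lia.
  move/card_gt0P => [y]; rewrite !inE => /and3P[yx yc yB].
  by exists y => //; apply: adjB; rewrite // eq_sym.
apply/eqP/negPn/negP => yz.
have [B AB [_ B3 _]] : exists2 B : {set W}, [set c; x; y; z] \subset B &
    [/\ c \in B, #|B| = 3 & {in B &, forall x y, x != y -> adj x y}].
  apply/blk/(@two_universal_nonseparable _ _ c x); rewrite ?inE ?eqxx ?orbT //.
  - by rewrite eq_sym.
  - by move=> w _; apply: hub.
  move=> w; rewrite !inE -!orbA => /or4P[] /eqP->; rewrite ?eqxx // => _.
  by rewrite adj_sym hub.
have xy' : x != y by apply/eqP => e; rewrite e adj_irrefl in xy.
have xz' : x != z by apply/eqP => e; rewrite e adj_irrefl in xz.
have := subset_leq_card AB; rewrite B3.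
have -> : [set c; x; y; z] = [set u in [:: c; x; y; z]].
  by apply/setP => u; rewrite !inE -!orbA.
rewrite cardsE (card_uniqP _) //= !inE !negb_or.
by rewrite ![c == _]eq_sym xc yc zc xy' xz' yz.
Qed.

Lemma linked_unpair (A : eqType) (ps : seq (A * A)) x y :
  linked ps x y -> x \in unpair ps.
Proof.
rewrite mem_unpair; case/orP => h; apply/hasP.
  by exists (x, y); rewrite //= eqxx.
by exists (y, x); rewrite //= eqxx orbT.
Qed.

(** Split off the first vertex of s with its only neighbour and recurse. *)
Lemma perfect_matching_pairs (A : eqType) (e : rel A) (s : seq A) :
  symmetric e -> irreflexive e -> uniq s ->
  {in s, forall x, exists2 y, y \in s & e x y} ->
  {in s & &, forall x y z, e x y -> e x z -> y = z} ->
  exists2 ps, perm_eq s (unpair ps) & {in s &, forall x y, e x y = linked ps x y}.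
Proof.
move=> eC eI; have [n] := ubnP (size s); elim: n s => // n IH s.
case: s => [|x s] le_n us ex_e un_e; first by exists [::].
have [y ys exy] := ex_e x (mem_head _ _).
have yx : y != x by apply/eqP => E; rewrite E eI in exy.
have {}ys : y \in s by move: ys; rewrite inE (negPf yx).
have xs : x \notin s by case/andP: us.
have u_s : uniq s by case/andP: us.
pose s' := rem y s.
have p_s : perm_eq (x :: s) (x :: y :: s').
  by rewrite perm_cons perm_to_rem.
have ms' z : (z \in s') = (z != y) && (z \in s) by rewrite mem_rem_uniq ?inE.
have sub z : z \in s' -> z \in x :: s by rewrite ms' inE => /andP[_ ->]; rewrite orbT.
have inx : x \in x :: s by rewrite mem_head.
have iny : y \in x :: s by rewrite inE ys orbT.
have out z : z \in s' -> ~~ e x z /\ ~~ e y z.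
  move=> zs'; have zs := sub z zs'; move: zs'; rewrite ms' => /andP[zy zin].
  split; apply/negP => E; first by rewrite (un_e x y z) ?inE ?eqxx ?ys ?zin ?orbT in zy.
  by move: xs; rewrite (un_e y x z) ?inE ?eqxx ?ys ?zin ?orbT // eC.
have [|||ps pps eps] := IH s' _ (rem_uniq _ u_s).
- by move: le_n; rewrite /= size_rem //; case: (s) ys => //= a l _; lia.
- move=> z zs'; have [w ws ezw] := ex_e z (sub _ zs'); exists w => //.
  have [/negP nx /negP ny] := out z zs'.
  move: ws; rewrite ms' inE => /predU1P[E|->].
    by case: nx; rewrite eC -E.
  by rewrite andbT; apply/eqP => E; case: ny; rewrite eC -E.
- by move=> a b d /sub a_s /sub b_s /sub d_s; apply: un_e.
exists ((x, y) :: ps).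
  by apply: perm_trans p_s _; rewrite /unpair /= !perm_cons.
have notin z w : (z == x) || (z == y) -> ~~ linked ps z w /\ ~~ linked ps w z.
  move=> zxy; suff: ~~ linked ps z w by rewrite /linked orbC.
  have zn : z \notin s'.
    by rewrite ms'; case/orP: zxy => /eqP->; rewrite ?(negPf xs) ?eqxx ?andbF.
  by apply: contra zn; rewrite (perm_mem pps); apply: linked_unpair.
have lc a b : linked ((x, y) :: ps) a b =
    ((a == x) && (b == y) || (a == y) && (b == x)) || linked ps a b.
  rewrite /linked !inE !xpair_eqE [(b == x) && _]andbC -!orbA.
  by do !bool_congr; rewrite orbCA.
move=> a b; rewrite !(perm_mem p_s) !inE lc => ain bin.
have xy : (x == y) = false by rewrite eq_sym (negPf yx).
case/or3P: ain => [/eqP->|/eqP->|a_s].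
- rewrite (negPf (notin x b _).1) ?eqxx // orbF xy orbF.
  case/or3P: bin => [/eqP->|/eqP->|b_s]; rewrite ?eI ?xy ?exy ?eqxx //.
  by rewrite (negPf (out b b_s).1); move: b_s; rewrite ms' => /andP[/negPf->].
- rewrite (negPf (notin y b _).1) ?eqxx ?orbT // orbF (negPf yx).
  case/or3P: bin => [/eqP->|/eqP->|b_s]; rewrite ?eI ?(negPf yx) //=.
    by rewrite eC exy eqxx.
  rewrite (negPf (out b b_s).2); case: eqP => // E.
  by move: b_s xs; rewrite ms' E => /andP[_ ->].
have ax : (a == x) = false.
  by apply/eqP => E; move: a_s xs; rewrite ms' E => /andP[_ ->].
have ay : (a == y) = false by move: a_s; rewrite ms' => /andP[/negPf->].
rewrite ax ay /=.
case/or3P: bin => [/eqP->|/eqP->|b_s]; last exact: eps.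
  by rewrite eC (negPf (out a a_s).1) (negPf (notin x a _).2) ?eqxx.
by rewrite eC (negPf (out a a_s).2) (negPf (notin y a _).2) ?eqxx ?orbT.
Qed.

Definition vane (A : Type) (c : A) (p : A * A) : A * A * A := (c, p.1, p.2).

Lemma windmill_triangulated (W : sgraph) :
  dutch_windmill W ->
  exists c ps, @triangulated W (c :: unpair ps) (map (vane c) ps).
Proof.
move=> [[_ tri] [c cB]]; have [hub ex_m un_m] := windmill_mate tri cB.
pose s := [seq x <- enum W | x != c].
have ms x : (x \in s) = (x != c) by rewrite mem_filter mem_enum andbT.
have [|||||ps pps eps] := @perfect_matching_pairs W (@adj W) s.
- exact: adj_sym.
- exact: adj_irrefl.
- by rewrite filter_uniq ?enum_uniq.
- by move=> x; rewrite ms => /ex_m[y yc xy]; exists y; rewrite ?ms.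
- by move=> x y z; rewrite !ms; apply: un_m.
have mp x : (x \in unpair ps) = (x != c) by rewrite -(perm_mem pps).
exists c, ps; split.
- by rewrite /= mp eqxx -(perm_uniq pps) filter_uniq ?enum_uniq.
- by move=> x; rewrite inE mp; case: eqP.
move=> x y; rewrite linked_sides has_map.
have -> : has (preim (vane c) (fun t => linked (tri_sides t) x y)) ps =
   ((x == c) && (y \in unpair ps) || (y == c) && (x \in unpair ps)) || linked ps x y.
  elim: (ps) => [|[p q] l IH]; first by rewrite /= !andbF.
  rewrite /= IH !mem_unpair /= -!mem_unpair /linked /tri_sides /vane /= !inE !xpair_eqE.
  move: (_ \in unpair l) (_ \in unpair l) (_ \in l) (_ \in l) => b1 b2 b3 b4.
  by case: (x == c); case: (y == c); case: (x == p); case: (x == q);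
     case: (y == p); case: (y == q); case: b1; case: b2; case: b3; case: b4.
rewrite !mp.
have np a b : ~~ linked ps c a /\ ~~ linked ps b c.
  suff h d : ~~ linked ps c d by split; rewrite // /linked orbC; apply: h.
  have: c \notin unpair ps by rewrite mp eqxx.
  by apply: contra; apply: linked_unpair.
have [->|xc] := eqVneq x c; have [->|yc] := eqVneq y c => /=.
- by rewrite adj_irrefl (negPf (np c c).1).
- by rewrite hub.
- by rewrite adj_sym hub.
by rewrite eps ?ms.
Qed.

(** * Codes of cacti *)

(** A code is the list of the vertices at which the successive triangles hang.
Vertex 0 is the centre; the i-th triangle brings in the vertices 2i + 1 and
2i + 2. *)
Definition code_triangles (c : seq nat) : seq (nat * nat * nat) :=
  [seq (nth 0 c i, i.*2.+1, i.*2.+2) | i <- iota 0 (size c)].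

(** Every triangle hangs at a vertex that precedes it. *)
Definition wf_code (c : seq nat) : bool :=
  all (fun t => t.1.1 < t.1.2) (code_triangles c).

(** The code describes the triangles on x0 :: vs only. The pairs ps are further
vanes at the centre x0 that carry nothing; they stay outside the code because
they are interchangeable and their number is arbitrary. *)
Definition coded_by (G : sgraph) (c : seq nat) (x0 : G) (vs : seq G)
    (ps : seq (G * G)) : Prop :=
  size vs = (size c).*2 /\
  triangulated (x0 :: vs ++ unpair ps)
    (map (tri_map (nth x0 (x0 :: vs))) (code_triangles c) ++ map (vane x0) ps).

Definition coded (G : sgraph) (c : seq nat) (n : nat) : Prop :=
  exists x0 vs ps, size ps = n /\ @coded_by G c x0 vs ps.

Lemma code_triangles_rcons c p :
  code_triangles (rcons c p) =
  rcons (code_triangles c) (p, (size c).*2.+1, (size c).*2.+2).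
Proof.
rewrite /code_triangles size_rcons -addn1 iotaD map_cat /= cats1.
rewrite nth_rcons ltnn eqxx; congr rcons.
apply/eq_in_map => i; rewrite mem_iota => /andP[_ Hi].
by rewrite nth_rcons; move: Hi; rewrite add0n => ->.
Qed.

Lemma wf_code_bound c t : wf_code c -> t \in code_triangles c ->
  [/\ t.1.1 < (size c).*2.+1, t.1.2 < (size c).*2.+1 & t.2 < (size c).*2.+1].
Proof.
move=> /allP wf tc; have := wf t tc.
by case/mapP: tc => i; rewrite mem_iota => /andP[_ Hi] -> /=; split; lia.
Qed.

Lemma wf_rcons c p : wf_code c -> p < (size c).*2.+1 -> wf_code (rcons c p).
Proof. by move=> wf Hp; rewrite /wf_code code_triangles_rcons all_rcons /= Hp. Qed.

Lemma code_triangles_extend (A : Type) (c : seq nat) (x0 : A) s s' :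
  wf_code c -> size s = (size c).*2.+1 ->
  map (tri_map (nth x0 (s ++ s'))) (code_triangles c) =
  map (tri_map (nth x0 s)) (code_triangles c).
Proof.
move=> wf ss; apply/eq_in_map => t /(wf_code_bound wf)[].
by rewrite -ss /tri_map !nth_cat => -> -> ->.
Qed.

(** A plain vane may be read as one more triangle of the code, at vertex 0. *)
Lemma coded_by_absorb (G : sgraph) c (x0 : G) vs a b ps :
  wf_code c -> coded_by c x0 vs ((a, b) :: ps) ->
  coded_by (rcons c 0) x0 (vs ++ [:: a; b]) ps.
Proof.
move=> wf [sv tr]; split; first by rewrite size_cat size_rcons sv /=; lia.
have E := @code_triangles_extend _ c x0 (x0 :: vs) [:: a; b] wf (f_equal S sv).
rewrite -catA code_triangles_rcons map_rcons {}E.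
have -> : tri_map (nth x0 (x0 :: vs ++ [:: a; b])) (0, (size c).*2.+1, (size c).*2.+2)
    = vane x0 (a, b).
  by rewrite /tri_map /= !nth_cat sv ltnn subnn ltnNge leqnSn /= subSnn.
by rewrite cat_rcons.
Qed.

Lemma coded_absorb (G : sgraph) c n :
  wf_code c -> coded G c n.+1 -> coded G (rcons c 0) n.
Proof.
move=> wf [x0 [vs [[|[a b] ps] [//= [sp] cG]]]].
by exists x0, (vs ++ [:: a; b]), ps; split=> //; apply: coded_by_absorb.
Qed.

Lemma coded_absorbn (G : sgraph) c n k :
  wf_code c -> coded G c (n + k) -> coded G (c ++ nseq k 0) n.
Proof.
elim: k n => [|k IH] n wf; first by rewrite addn0 cats0.
rewrite addnS => cG; have := IH n.+1 wf cG => {}cG.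
have -> : c ++ nseq k.+1 0 = rcons (c ++ nseq k 0) 0.
  by rewrite -cats1 -catA; congr cat; elim: (k) => //= m ->.
apply: coded_absorb cG; elim: (k) => [|m IHm]; first by rewrite cats0.
have -> : c ++ nseq m.+1 0 = rcons (c ++ nseq m 0) 0.
  by rewrite -cats1 -catA; congr cat; elim: (m) => //= m' ->.
exact: wf_rcons.
Qed.

Lemma coded_by_perm (G : sgraph) c (x0 : G) vs ps ps' :
  perm_eq ps ps' -> coded_by c x0 vs ps -> coded_by c x0 vs ps'.
Proof.
move=> pp [sv tr]; split=> //; apply: eq_triangulated tr.
  by rewrite perm_cons perm_cat2l; apply/perm_flatten/perm_map.
move=> x y; rewrite !linked_sides; apply: eq_has_r => t.
by rewrite !mem_cat (perm_mem (perm_map (vane x0) pp)).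
Qed.

Lemma coded_by_flip (G : sgraph) c (x0 : G) vs a b ps :
  coded_by c x0 vs ((a, b) :: ps) -> coded_by c x0 vs ((b, a) :: ps).
Proof.
move=> [sv tr]; split=> //; apply: eq_triangulated tr.
  by rewrite perm_cons perm_cat2l /= (perm_catCA [:: a] [:: b]).
move=> x y; rewrite !linked_sides !has_cat /= /vane; congr (_ || (_ || _)).
rewrite /linked /tri_sides /= !inE !xpair_eqE.
by case: (x == x0); case: (y == x0); case: (x == a); case: (x == b);
   case: (y == a); case: (y == b).
Qed.

(** Plain vanes may be permuted and their two outer vertices exchanged, so any
outer vertex can be taken to be the very first one. *)
Lemma coded_by_front (G : sgraph) c (x0 : G) vs ps v :
  coded_by c x0 vs ps -> v \in unpair ps ->
  exists b ps', size ps = (size ps').+1 /\ coded_by c x0 vs ((v, b) :: ps').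
Proof.
move=> cG; rewrite mem_unpair => /hasP[[p q] pps /= vpq].
have pp := perm_to_rem pps; have {cG}cG := coded_by_perm pp cG.
have sp : size ps = (size (rem (p, q) ps)).+1 by rewrite (perm_size pp).
case/orP: vpq => /eqP->; first by exists q, (rem (p, q) ps).
by exists p, (rem (p, q) ps); split=> //; apply: coded_by_flip.
Qed.

Lemma coded_by_pendant (H K : sgraph) (v : H) c x0 vs ps :
  wf_code c -> coded_by c x0 vs ps -> v \in x0 :: vs ->
  isomorphic (add_pendant v) K ->
  if v == x0 then coded K c (size ps).+1
  else coded K (rcons c (index v (x0 :: vs))) (size ps).
Proof.
move=> wf [sv tr] vin [h h_bij h_adj].
have := triangulated_pendant h_bij h_adj tr.
set y := h (inr false); set z := h (inr true); set f := h \o _.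
have fT : map (tri_map f)
      (map (tri_map (nth x0 (x0 :: vs))) (code_triangles c) ++ map (vane x0) ps) =
    map (tri_map (nth (f x0) (f x0 :: map f vs))) (code_triangles c)
      ++ map (vane (f x0)) (map (pair_map f) ps).
  rewrite map_cat; congr cat; last by rewrite -!map_comp.
  rewrite -[LHS]map_comp; apply/eq_in_map => t tc; have [t1 t2 t3] := wf_code_bound wf tc.
  rewrite /= /tri_map /= -[_ :: map f vs]/(map f (x0 :: vs)).
  by rewrite !(nth_map x0) //= sv.
rewrite {}fT -[h (inl v)]/(f v) /= map_cat map_unpair => trK.
move: vin; rewrite inE eq_sym /=; case: eqP => [E _|_ /= vvs].
  exists (f x0), (map f vs), (map (pair_map f) ps ++ [:: (y, z)]).
  split; first by rewrite size_cat size_map addn1.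
  split; first by rewrite size_map.
  rewrite unpair_cat map_cat; move: trK; rewrite -cats1 -!catA -E.
  exact.
exists (f x0), (map f vs ++ [:: y; z]), (map (pair_map f) ps).
split; first by rewrite size_map.
split; first by rewrite size_cat size_map size_rcons sv /=; lia.
have E := @code_triangles_extend _ c (f x0) (f x0 :: map f vs) [:: y; z] wf.
rewrite code_triangles_rcons map_rcons {}E; last by rewrite /= size_map sv.
apply: eq_triangulated trK.
  by rewrite -!catA perm_cons perm_cat2l perm_catC.
have -> : tri_map (nth (f x0) ((f x0 :: map f vs) ++ [:: y; z]))
    ((index v vs).+1, (size c).*2.+1, (size c).*2.+2) = (f v, y, z).
  have lv : index v vs < size vs by rewrite index_mem.
  rewrite /tri_map /= !nth_cat size_map -sv lv (nth_map x0) // nth_index //.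
  by rewrite ltnn subnn ltnNge leqnSn /= subSnn.
move=> p q; rewrite !linked_sides; apply: eq_has_r => t.
by rewrite cat_rcons mem_rcons inE !mem_cat inE orbCA.
Qed.

(** A triangle at the centre is a plain vane, and one at a vertex of the code
extends the code. One at a plain vane first makes this vane the last triangle of
the code; its first outer vertex then has the number 2 |c| + 1. *)
Lemma coded_pendant (H K : sgraph) (v : H) c n :
  wf_code c -> coded H c n -> isomorphic (add_pendant v) K ->
  exists m,
  [\/ coded K c m,
      exists2 i, 0 < i < (size c).*2.+1 & coded K (rcons c i) m
    | coded K (rcons (rcons c 0) (size c).*2.+1) m].
Proof.
move=> wf [x0 [vs [ps [_ cH]]]] iK.
have [vin|vout] := boolP (v \in x0 :: vs).
  have := coded_by_pendant wf cH vin iK; case: eqP => [_|v0] cK.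
    by exists (size ps).+1; apply: Or31.
  exists (size ps); apply: Or32; exists (index v (x0 :: vs)) => //.
  case: cH => <- _; move: vin; rewrite -index_mem /= => ->.
  by rewrite eq_sym; case: eqP v0.
have vps : v \in unpair ps.
  have [_ [_ /(_ v)]] := cH.
  by move: vout; rewrite !inE mem_cat => /norP[/negPf-> /negPf->].
have [b [ps' [_ {}cH]]] := coded_by_front cH vps.
have vvs : v \notin vs by move: vout; rewrite inE => /norP[].
have v0 : (v == x0) = false by move: vout; rewrite inE => /norP[/negPf].
have {}cH := coded_by_absorb wf cH.
have sv : size vs = (size c).*2.
  by case: cH; rewrite size_cat size_rcons /=; lia.
have := coded_by_pendant (wf_rcons wf _) cH _ iK; rewrite v0.
rewrite inE v0 mem_cat mem_head orbT => /(_ isT isT).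
rewrite /= eq_sym v0 index_cat (negPf vvs) /= eqxx addn0 sv => cK.
by exists (size ps'); apply: Or33.
Qed.

(** * The shapes with at most three pendants *)

(** Puts the two outer vertices in order: exchanging them changes the code of
what hangs there but not the graph. *)
Definition tri_sort (t : nat * nat * nat) : nat * nat * nat :=
  if t.1.2 <= t.2 then t else (t.1.1, t.2, t.1.2).

(** The renumbering pi takes the vertices of c' to those of c. *)
Definition code_iso (c c' pi : seq nat) : bool :=
  [&& size c' == size c, wf_code c', head 1 pi == 0,
      perm_eq pi (iota 0 (size c).*2.+1)
    & perm_eq (map tri_sort (map (tri_map (nth 0 pi)) (code_triangles c')))
              (map tri_sort (code_triangles c))].

Lemma linked_tri_sort (A : eqType) (g : nat -> A) t x y :
  linked (tri_sides (tri_map g (tri_sort t))) x y =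
  linked (tri_sides (tri_map g t)) x y.
Proof.
case: t => [[i j] k]; rewrite /tri_sort /=; case: ifP => // _.
rewrite /linked /tri_sides /= !inE !xpair_eqE.
by case: (x == g i); case: (x == g j); case: (x == g k);
   case: (y == g i); case: (y == g j); case: (y == g k).
Qed.

Lemma has_tri_sort (A : eqType) (g : nat -> A) T x y :
  has (fun t => linked (tri_sides t) x y) (map (tri_map g) (map tri_sort T)) =
  has (fun t => linked (tri_sides t) x y) (map (tri_map g) T).
Proof. by rewrite !has_map; apply: eq_has => t /=; rewrite linked_tri_sort. Qed.

Lemma coded_iso (G : sgraph) c c' pi n :
  wf_code c -> code_iso c c' pi -> coded G c n -> coded G c' n.
Proof.
move=> wf /and5P[/eqP sc wf' /eqP pi0 ppi pT] [x0 [vs [ps [sp [sv tr]]]]].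
have spi : size pi = (size c).*2.+1 by rewrite (perm_size ppi) size_iota.
set V := x0 :: vs in tr.
have sV : size V = (size c).*2.+1 by rewrite /= sv.
have pV : perm_eq V (map (nth x0 V) pi).
  by rewrite perm_sym -[X in perm_eq _ X](mkseq_nth x0) sV; apply: perm_map.
have eV : map (nth x0 V) pi = x0 :: behead (map (nth x0 V) pi).
  by case: pi pi0 {ppi pT spi pV} => //= a l ->.
exists x0, (behead (map (nth x0 V) pi)), ps; split=> //; split.
  by rewrite size_behead size_map spi sc.
rewrite -cat_cons -!eV; apply: eq_triangulated tr.
  by rewrite -cat_cons perm_cat2r.
have -> : map (tri_map (nth x0 (map (nth x0 V) pi))) (code_triangles c') =
    map (tri_map (nth x0 V)) (map (tri_map (nth 0 pi)) (code_triangles c')).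
  rewrite -map_comp; apply/eq_in_map => t tc.
  have [] := wf_code_bound wf' tc; rewrite sc -spi => t1 t2 t3.
  by rewrite /tri_map /= !(nth_map 0).
move=> x y; rewrite !linked_sides !has_cat; congr orb.
rewrite -has_tri_sort -[RHS]has_tri_sort.
by apply/eq_has_r/perm_mem/perm_map; rewrite perm_sym.
Qed.
(** Up to isomorphism, the forms that at most three pendants may take together
with the vanes that carry them. *)
Definition cactus_codes : seq (seq nat) :=
  [:: [::];
      [:: 0; 1];
      [:: 0; 1; 1];
      [:: 0; 1; 2];
      [:: 0; 1; 3];
      [:: 0; 1; 0; 5];
      [:: 0; 1; 1; 1];
      [:: 0; 1; 1; 2];
      [:: 0; 1; 1; 3];
      [:: 0; 1; 1; 0; 7];
      [:: 0; 1; 2; 3];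
      [:: 0; 1; 2; 0; 7];
      [:: 0; 1; 3; 3];
      [:: 0; 1; 3; 4];
      [:: 0; 1; 3; 5];
      [:: 0; 1; 3; 0; 7];
      [:: 0; 1; 0; 5; 0; 9]].

(** The renumberings that bring the codes obtained from [cactus_codes] by one
more pendant back to [cactus_codes]. *)
Definition code_isos : seq (seq nat) :=
  [:: [:: 0; 1; 2; 3; 4];
      [:: 0; 1; 2; 3; 4; 5; 6];
      [:: 0; 1; 2; 4; 3; 5; 6];
      [:: 0; 1; 2; 3; 4; 5; 6; 7; 8];
      [:: 0; 1; 2; 4; 3; 5; 6; 7; 8];
      [:: 0; 1; 2; 5; 6; 3; 4; 7; 8];
      [:: 0; 1; 2; 6; 5; 3; 4; 7; 8];
      [:: 0; 1; 2; 3; 4; 5; 6; 7; 8; 9; 10];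
      [:: 0; 1; 2; 3; 4; 7; 8; 5; 6];
      [:: 0; 2; 1; 5; 6; 7; 8; 3; 4];
      [:: 0; 2; 1; 5; 6; 3; 4; 7; 8];
      [:: 0; 2; 1; 6; 5; 3; 4; 7; 8];
      [:: 0; 1; 2; 3; 4; 6; 5; 7; 8];
      [:: 0; 1; 2; 3; 4; 9; 10; 5; 6; 7; 8];
      [:: 0; 1; 2; 4; 3; 9; 10; 5; 6; 7; 8];
      [:: 0; 5; 6; 7; 8; 9; 10; 1; 2; 3; 4];
      [:: 0; 5; 6; 8; 7; 9; 10; 1; 2; 3; 4];
      [:: 0; 1; 2; 3; 4; 5; 6; 7; 8; 9; 10; 11; 12]].


(** The triangles that hang at vertex 0 are vanes. *)
Definition pendants (c : seq nat) : nat := count (fun p => p != 0) c.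

(** The codes of [coded_pendant]: the new triangle hangs at a plain vane, which
comes first, or at a vertex of the code other than the centre. *)
Definition code_extensions (c : seq nat) : seq (seq nat) :=
  rcons (rcons c 0) (size c).*2.+1 :: [seq rcons c i | i <- iota 1 (size c).*2].

Lemma cactus_codes_extend :
  all (fun c => wf_code c && ((pendants c < 3) ==>
    all (fun d => has (fun c' => (pendants c' == (pendants c).+1)
                        && has (code_iso d c') code_isos) cactus_codes)
        (code_extensions c))) cactus_codes.
Proof. by vm_compute. Qed.

Lemma cactus_codes_complete (W G : sgraph) k :
  dutch_windmill W -> k <= 3 -> with_pendants W k G ->
  exists2 c, c \in cactus_codes & pendants c <= k /\ exists n, coded G c n.
Proof.
move=> wW + wp; elim: wp => [|{}k H K v _ IH iK] kle3.
  have [x0 [ps tr]] := windmill_triangulated wW.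
  by exists [::] => //; split=> //; exists (size ps), x0, [::], ps.
have [c cc [pc [n cH]]] := IH (ltnW kle3).
have /andP[wf /implyP ext] := allP cactus_codes_extend _ cc.
have {}ext := allP (ext (leq_ltn_trans pc kle3)).
suff new d m : d \in code_extensions c -> wf_code d -> coded K d m ->
    exists2 c, c \in cactus_codes & pendants c <= k.+1 /\ exists n, coded K c n.
  have [m []] := coded_pendant wf cH iK.
  - by move=> cK; exists c => //; split; [apply: leqW | exists m].
  - move=> [i /andP[i0 Hi]]; apply: new; last exact: wf_rcons.
    by rewrite inE map_f ?orbT // mem_iota i0 /= add1n.
  apply: new; first by rewrite mem_head.
  by rewrite !wf_rcons // size_rcons; lia.
move=> /ext /hasP[c' cc' /andP[/eqP pc' /hasP[pi _ iso]]] wfd cK.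
exists c' => //; split; first by rewrite pc'.
by exists m; apply: coded_iso iso cK.
Qed.

(** * From numbers to labellings *)

(** One of the two truncated differences vanishes. *)
Definition dist (m n : nat) : nat := (m - n) + (n - m).

Lemma distC m n : dist m n = dist n m.
Proof. exact: addnC. Qed.

Lemma dist_addr m n : dist m (m + n) = n.
Proof. by rewrite /dist addKn subnDA subnn sub0n. Qed.

Lemma edge_label_dist (G : sgraph) (f : G -> nat) u v :
  edge_label f u v = dist (f u) (f v).
Proof. by rewrite /edge_label /dist; lia. Qed.

Definition labels_of (T : seq (nat * nat * nat)) : seq nat :=
  [seq dist p.1 p.2 | p <- sides T].

Lemma unpair_inj (A : Type) : injective (@unpair A).
Proof.
by elim=> [|[a b] l IH] [|[a' b'] l'] //= [-> -> /IH->].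
Qed.

Lemma uniq_map_inj (A B : eqType) (f : A -> B) (s : seq A) :
  uniq (map f s) -> {in s &, injective f}.
Proof.
elim: s => //= a s IH /andP[fa /IH f_inj] x y; rewrite !inE.
case/predU1P=> [->|xs]; case/predU1P=> [->|ys] // E; last exact: f_inj.
  by rewrite E map_f in fa.
by rewrite -E map_f in fa.
Qed.

Section Labelling.

Variables (G : sgraph) (V : seq G) (T : seq (G * G * G)) (f : G -> nat).
Hypothesis trG : triangulated V T.

Let D := labels_of (map (tri_map f) T).
Let d (p : G * G) : nat := dist (f p.1) (f p.2).
Let e (p : G * G) : {set G} := [set p.1; p.2].

Lemma labels_of_map : D = map d (sides T).
Proof. by rewrite /D /labels_of -map_sides -map_comp. Qed.

Lemma triangulated_inj : uniq (map f V) -> injective f.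
Proof.
case: trG => uV aV _ ufV x y; exact: (uniq_map_inj ufV).
Qed.

Lemma adj_side x y : adj x y ->
  exists2 p, p \in sides T & e p = [set x; y] /\ d p = dist (f x) (f y).
Proof.
case: trG => _ _ -> /orP[h|h]; first by exists (x, y).
by exists (y, x) => //; split; [rewrite /e setUC | rewrite /d distC].
Qed.

Lemma side_adj p : p \in sides T -> adj p.1 p.2.
Proof. by case: trG => _ _ -> h; rewrite /linked -surjective_pairing h. Qed.

Lemma same_set_dist p q : e p = e q -> d p = d q.
Proof.
move=> E; have mE x : (x \in e p) = (x \in e q) by rewrite E.
have := (mE p.1, mE p.2, mE q.1, mE q.2).
rewrite !inE !eqxx !orbT /d => -[[[h1 h2] h3] h4].
move: h1 h2; rewrite !(eq_sym p.1) !(eq_sym p.2) in h3 h4 *.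
case/esym/orP=> /eqP e1; case/esym/orP=> /eqP e2; rewrite -?e1 -?e2 //.
- by move: h4; rewrite -e1 -e2 orbb => /eqP->.
- exact: distC.
- by move: h3; rewrite -e1 -e2 orbb => /eqP->.
Qed.

(** The label of a side depends only on its two ends as a set. Hence distinct
labels force the sides of the triangles to be distinct edges. *)
Lemma card_edges : uniq D -> #|edges G| = 3 * size T.
Proof.
rewrite labels_of_map => uD; have d_inj := uniq_map_inj uD.
rewrite -size_sides -(size_map e); have uE : uniq (map e (sides T)).
  rewrite map_inj_in_uniq ?(map_uniq uD) // => p q pT qT /same_set_dist.
  exact: d_inj.
rewrite -(card_uniqP uE); apply: eq_card => A; apply/imsetP/mapP.
  by move=> [[x y]]; rewrite inE => /adj_side[p pT [ep _]] ->; exists p.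
by move=> [p pT ->]; exists p; rewrite // inE side_adj.
Qed.

Lemma labels_edge_label_bij (L : pred nat) :
  uniq D -> (forall k, L k = (k \in D)) -> edge_label_bij f L.
Proof.
rewrite labels_of_map => uD LD; have d_inj := uniq_map_inj uD; split.
- move=> u v /adj_side[p pT [_ dp]].
  by rewrite LD edge_label_dist -dp map_f.
- move=> u v x y /adj_side[p pT [<- dp]] /adj_side[q qT [<- dq]].
  by rewrite !edge_label_dist -dp -dq => /(d_inj _ _ pT qT)->.
move=> k; rewrite LD => /mapP[p pT ->].
by exists p.1, p.2; rewrite side_adj // edge_label_dist.
Qed.

End Labelling.

Definition top_label (N : nat) : nat := if N %% 4 < 2 then 3 * N else (3 * N).+1.

(** The three labels of a triangle have an even sum, so the sum of all labels is
even. The sum of 1, ..., 3N is even exactly when N = 0, 1 mod 4; otherwise 3N has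
to give way to 3N + 1. *)
Definition target (N : nat) : seq nat :=
  if N %% 4 < 2 then iota 1 (3 * N) else rcons (iota 1 (3 * N).-1) (3 * N).+1.

Lemma size_target N : size (target N) = 3 * N.
Proof.
rewrite /target; case: ifP => H; first by rewrite size_iota.
by rewrite size_rcons size_iota; lia.
Qed.

Lemma uniq_target N : uniq (target N).
Proof.
rewrite /target; case: ifP => H; first exact: iota_uniq.
by rewrite rcons_uniq iota_uniq andbT mem_iota; lia.
Qed.

Lemma mem_target N k :
  (k \in target N) =
  if N %% 4 < 2 then 0 < k <= 3 * N else (0 < k < 3 * N) || (k == (3 * N).+1).
Proof.
rewrite /target; case: ifP => _; rewrite ?mem_rcons ?in_cons mem_iota; last by lia.
by rewrite add1n ltnS.
Qed.

(** There are as many sides as target labels. So it is enough that every target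
label occurs: then none occurs twice, and no other label occurs. *)
Lemma labelled_graceful (G : sgraph) (V : seq G) T (f : G -> nat) :
  triangulated V T -> uniq (map f V) ->
  (forall x, x \in V -> f x <= top_label (size T)) ->
  {subset target (size T) <= labels_of (map (tri_map f) T)} ->
  graceful G \/ near_graceful G.
Proof.
move=> tr ufV fle sub; set D := labels_of _ in sub.
have sD : size D = 3 * size T by rewrite /D size_map size_sides size_map.
have uD : uniq D by apply: leq_size_uniq sub _; rewrite ?uniq_target // size_target sD.
have [_ eD] : (size (target (size T)) = size D) * (target (size T) =i D).
  by apply: uniq_min_size; rewrite ?uniq_target // size_target sD.
have f_inj := triangulated_inj tr ufV; have cE := card_edges tr uD.
have all_le v : f v <= top_label (size T) by case: (tr) => _ aV _; apply: fle.
have bij := labels_edge_label_bij tr uD.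
rewrite /top_label in all_le.
have mD k : (k \in D) = (k \in target (size T)) by rewrite eD.
case: ifP all_le => r4 all_le; [left | right]; exists f; split; rewrite ?cE //.
  by apply: bij => k; rewrite mD mem_target r4.
by right; apply: bij => k; rewrite mD mem_target r4; lia.
Qed.

Definition label_triangles (c lab : seq nat) (qs : seq (nat * nat)) :
    seq (nat * nat * nat) :=
  map (tri_map (nth 0 lab)) (code_triangles c) ++ map (vane (nth 0 lab 0)) qs.

Lemma coded_graceful (G : sgraph) c n lab qs :
  wf_code c -> coded G c n -> size lab = (size c).*2.+1 -> size qs = n ->
  uniq (lab ++ unpair qs) ->
  {in lab ++ unpair qs, forall k, k <= top_label (size c + n)} ->
  {subset target (size c + n) <= labels_of (label_triangles c lab qs)} ->
  graceful G \/ near_graceful G.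
Proof.
move=> wf [x0 [vs [ps [sp [sv tr]]]]] sl sq ul le_l sub.
set V := _ :: _ in tr; pose L := lab ++ unpair qs.
pose f x := nth 0 L (index x V).
have sLV : size L = size V.
  by rewrite /L /V /= !size_cat !size_unpair sl sv sp sq.
have uV : uniq V by case: tr.
have fV : map f V = L.
  apply: (@eq_from_nth _ 0); rewrite size_map // => i Hi.
  by rewrite (nth_map x0) // /f index_uniq.
have [fvs fps] : map f (x0 :: vs) = lab /\ map f (unpair ps) = unpair qs.
  move: fV; rewrite /V -cat_cons map_cat /L => /eqP.
  by rewrite eqseq_cat ?size_map /= ?sv ?sl // => /andP[/eqP-> /eqP->].
have {}fps : map (pair_map f) ps = qs.
  by apply: unpair_inj; rewrite -map_unpair.
have fT : map (tri_map f) (map (tri_map (nth x0 (x0 :: vs))) (code_triangles c)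
    ++ map (vane x0) ps) = label_triangles c lab qs.
  rewrite map_cat /label_triangles; congr cat.
    rewrite -[LHS]map_comp; apply/eq_in_map => t tc.
    have [t1 t2 t3] := wf_code_bound wf tc.
    by rewrite -fvs /tri_map /= -[_ :: map f vs]/(map f (x0 :: vs)) !(nth_map x0) //= sv.
  rewrite -fps -!map_comp; apply: eq_map => p /=.
  by rewrite -fvs.
have sT : size (map (tri_map (nth x0 (x0 :: vs))) (code_triangles c)
    ++ map (vane x0) ps) = size c + n.
  by rewrite size_cat !size_map size_iota sp.
apply: (labelled_graceful tr (f := f)); rewrite ?sT ?fT ?fV //.
by move=> x xV; apply: le_l; rewrite -/L -fV map_f.
Qed.

(** * Langford sequences *)

Definition langford_positions (l : nat) (hooked : bool) : seq nat :=
  if hooked then rcons (iota 1 (2 * l).-1) (2 * l).+1 else iota 1 (2 * l).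

Lemma size_langford_positions l hooked : 0 < l ->
  size (langford_positions l hooked) = 2 * l.
Proof.
by rewrite /langford_positions; case: hooked; rewrite ?size_rcons size_iota //; lia.
Qed.

Lemma uniq_langford_positions l hooked : uniq (langford_positions l hooked).
Proof.
rewrite /langford_positions; case: hooked; last exact: iota_uniq.
by rewrite rcons_uniq iota_uniq mem_iota andbT; lia.
Qed.

(** The inclusions amount to equality, since both sides have the same size. *)
Definition langford (d l : nat) (hooked : bool) (ps : seq (nat * nat)) : Prop :=
  [/\ size ps = l, {subset langford_positions l hooked <= unpair ps}
    & {subset iota d l <= [seq dist p.1 p.2 | p <- ps]}].

(** The pair (p, q) is the linear function t |-> p * t + q; a whole family of
sequences, indexed by t, is handled at once. *)
Definition lin : Type := (nat * nat)%type.

Definition ev (t : nat) (x : lin) : nat := x.1 * t + x.2.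

Definition ladd (x y : lin) : lin := (x.1 + y.1, x.2 + y.2).

Definition lpred (x : lin) : lin := (x.1, x.2.-1).

Definition lhalf (x : lin) : lin := (x.1./2, x.2./2).

(** The nest (a, c, k) consists of k pairs, each inside the previous one. The
lower ends go up from a, and the distances go down in steps of 2 to c. *)
Definition nest : Type := (lin * lin * lin)%type.

Definition nest_pairs (t : nat) (s : nest) : seq (nat * nat) :=
  let: (a, c, k) := s in
  [seq (ev t a + r, ev t a + r + (ev t c + 2 * (ev t k - r.+1))) | r <- iota 0 (ev t k)].

(** Half-open intervals, each of which begins where the previous one ends, from x
to y. The end points are compared as linear functions, so that one computation
settles all t. *)
Fixpoint chain (x : lin) (segs : seq (lin * lin)) (y : lin) : bool :=
  if segs is (lo, hi) :: segs' then (lo == x) && chain hi segs' y else x == y.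

Definition sort_segs : seq (lin * lin) -> seq (lin * lin) :=
  sort (fun s s' => (s.1.1 < s'.1.1) || (s.1.1 == s'.1.1) && (s.1.2 <= s'.1.2)).

Definition low_seg (s : nest) : lin * lin := let: (a, c, k) := s in (a, ladd a k).

(** The highest of the upper ends belongs to the first pair and is
a + c + 2(k - 1). *)
Definition high_seg (s : nest) : lin * lin :=
  let: (a, c, k) := s in
  let: h := lpred (ladd (ladd a c) k) in (h, ladd h k).

(** The distances in a nest have the parity of c; their halves form an interval. *)
Definition diff_seg (s : nest) : lin * lin :=
  let: (a, c, k) := s in (lhalf c, ladd (lhalf c) k).

(** Positions must form one chain; in the hooked case the unused position 2l is
inserted to close the gap. The even and the odd distances must form one chain
each after halving. Slopes have to be even where a number is halved, so that its
parity is the same for all t. *)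
Definition langford_check (d : nat) (l : lin) (hooked : bool) (ns : seq nest) : bool :=
  let: pos := flatten [seq [:: low_seg s; high_seg s] | s <- ns] in
  let: l2 := ladd l l in
  let: hole := if hooked then [:: (l2, ladd l2 (0, 1))] else [::] in
  [&& ~~ odd l.1, all (fun s : nest => ~~ odd s.1.2.1 && (0 < s.1.2.2)) ns,
      foldr (fun s : nest => ladd s.2) (0, 0) ns == l,
      chain (0, 1) (sort_segs (hole ++ pos)) (ladd l2 (0, 1 + hooked))
    & all (fun b => chain (0, (d + ~~ b)./2)
             (sort_segs [seq diff_seg s | s <- ns & odd s.1.2.2 == b])
             (l.1./2, (d + l.2 + ~~ b)./2)) [:: true; false]].

Lemma ev_add t x y : ev t (ladd x y) = ev t x + ev t y.
Proof. by rewrite /ev /=; lia. Qed.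

Lemma ev_half t x : ~~ odd x.1 -> ev t (lhalf x) = (ev t x)./2.
Proof.
move=> ox; rewrite /ev /= -{2}[x.1]odd_double_half (negPf ox) add0n.
by rewrite -!muln2 -mulnA [2 * t]mulnC mulnA muln2 halfD odd_double add0n doubleK.
Qed.

Lemma chain_cover t x segs y v : chain x segs y -> ev t x <= v < ev t y ->
  exists2 s, s \in segs & ev t s.1 <= v < ev t s.2.
Proof.
elim: segs x => [|[lo hi] segs IH] x /=; first by move/eqP->; lia.
move=> /andP[/eqP<- ch] /andP[le_v v_lt]; have [v_hi|hi_v] := ltnP v (ev t hi).
  by exists (lo, hi); rewrite ?mem_head //= le_v.
have [|s ss vs] := IH hi ch; first by rewrite hi_v.
by exists s => //; rewrite inE ss orbT.
Qed.

Lemma langford_checkP d l hooked ns t :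
  langford_check d l hooked ns ->
  langford d (ev t l) hooked (flatten (map (nest_pairs t) ns)).
Proof.
move=> /and5P[ol /allP par /eqP sum cpos cdiff].
set ps := flatten _.
have mem_ps s r : s \in ns -> r < ev t s.2 ->
    (ev t s.1.1 + r, ev t s.1.1 + r + (ev t s.1.2 + 2 * (ev t s.2 - r.+1))) \in ps.
  case: s => [[a c] k] sn Hr; apply/flatten_mapP; exists (a, c, k) => //.
  by apply/mapP; exists r; rewrite // mem_iota.
split.
- rewrite -sum /ps; elim: (ns) => //= -[[a c] k] ns' IH.
  by rewrite size_cat IH ev_add size_map size_iota.
- move=> x xpos.
  have [] := chain_cover (t := t) (v := x) cpos.
    move: xpos; rewrite /langford_positions !ev_add /ev /= mul0n.
    by case: (hooked); rewrite ?mem_rcons ?inE mem_iota; lia.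
  move=> sg; rewrite mem_sort mem_cat => /orP[|].
    case: (hooked) xpos => // xpos; rewrite inE => /eqP->.
    move: xpos; rewrite /langford_positions mem_rcons inE mem_iota !ev_add /=.
    by rewrite /ev /= mul0n; lia.
  case/flatten_mapP=> -[[a c] k] sn; have /andP[_ /= c0] := par _ sn.
  rewrite !inE => /orP[] /eqP->; rewrite /low_seg /high_seg /= ?ev_add => Hx.
    have Hr : x - ev t a < ev t k by lia.
    rewrite mem_unpair; apply/hasP; eexists; first exact: mem_ps sn Hr.
    by rewrite /=; apply/orP; left; apply/eqP; lia.
  have e : ev t (lpred (ladd (ladd a c) k)) = (ev t a + ev t c + ev t k).-1.
    by rewrite /ev /=; lia.
  rewrite e in Hx; have c0' : 0 < ev t c by rewrite /ev; lia.
  have Hr : (ev t a + ev t c + 2 * ev t k) - 2 - x < ev t k by lia.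
  rewrite mem_unpair; apply/hasP; eexists; first exact: mem_ps sn Hr.
  by rewrite /=; apply/orP; right; apply/eqP; lia.
move=> x; rewrite mem_iota => xd.
have /(chain_cover (t := t) (v := x./2)) : chain (0, (d + ~~ odd x)./2)
      (sort_segs [seq diff_seg s | s <- ns & odd s.1.2.2 == odd x])
      (l.1./2, (d + l.2 + ~~ odd x)./2).
  by apply: (allP cdiff); case: (odd x).
have e : ev t (l.1./2, (d + l.2 + ~~ odd x)./2) = (d + ev t l + ~~ odd x)./2.
  rewrite -[(_, _)]/(lhalf (l.1, d + l.2 + ~~ odd x)) ev_half // /ev /=.
  by congr half; lia.
rewrite e => -[|sg].
  by rewrite {1}/ev /= mul0n add0n; have := odd_double_half x;
    case: (odd x) => /= ?; lia.
rewrite /sort_segs mem_sort => /mapP[[[a c] k]]; rewrite mem_filter => /andP[/eqP /= oc sn] ->.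
have /andP[/= oc1 _] := par _ sn.
rewrite /= ev_add ev_half // => Hx.
have oe : odd (ev t c) = odd x by rewrite /ev oddD oddM (negPf oc1).
pose j := x./2 - (ev t c)./2; have Hj : j < ev t k by rewrite /j; clear -Hx; lia.
have Hr : ev t k - j.+1 < ev t k by clear -Hj; lia.
apply/mapP; eexists; first exact: mem_ps sn Hr.
have -> : ev t k - (ev t k - j.+1).+1 = j by clear -Hj; lia.
have jE : j + (ev t c)./2 = x./2 by rewrite /j subnK //; case/andP: Hx.
rewrite /= dist_addr -[x in LHS]odd_double_half -jE doubleD addnCA -oe.
by rewrite odd_double_half addnC mul2n.
Qed.

(** The i-th entry of s is the lower end of a pair at distance d + i; each pair is
a nest of its own. *)
Definition sporadic (d : nat) (s : seq nat) : seq nest :=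
  [seq (0, nth 0 s i, (0, d + i), (0, 1)) | i <- iota 0 (size s)].

(** Lower ends as in [sporadic], for l = 13, ..., 43. *)
Definition short_langford7 : seq (seq nat) :=
  [:: [:: 11; 8; 10; 5; 3; 13; 9; 12; 6; 1; 7; 2; 4];
      [:: 15; 16; 9; 4; 8; 1; 10; 3; 11; 5; 12; 2; 6; 7];
      [:: 11; 19; 8; 16; 2; 10; 1; 15; 5; 9; 4; 6; 12; 3; 7];
      [:: 22; 8; 9; 3; 19; 15; 4; 7; 10; 12; 14; 2; 5; 6; 11; 1];
      [:: 19; 16; 23; 2; 17; 1; 5; 6; 7; 15; 4; 9; 14; 10; 8; 3; 11];
      [:: 4; 7; 18; 20; 12; 25; 21; 8; 2; 3; 16; 10; 13; 6; 14; 9; 1; 5];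
      [:: 2; 24; 20; 3; 22; 11; 14; 5; 21; 1; 18; 16; 6; 10; 7; 4; 8; 15; 12];
      [:: 3; 22; 17; 28; 7; 1; 12; 20; 24; 16; 2; 5; 21; 15; 8; 14; 4; 9; 6; 11];
      [:: 34; 13; 29; 7; 1; 14; 27; 18; 22; 19; 3; 5; 6; 8; 10; 2; 16; 9; 11; 4;
       15];
      [:: 4; 24; 3; 29; 26; 2; 30; 21; 13; 7; 10; 16; 6; 20; 1; 19; 15; 9; 17; 5;
       18; 8];
      [:: 38; 11; 18; 34; 4; 24; 1; 7; 28; 10; 13; 23; 20; 2; 16; 25; 8; 5; 17;
       9; 6; 12; 3];
      [:: 36; 34; 2; 3; 4; 5; 16; 21; 24; 25; 9; 19; 12; 27; 7; 18; 23; 8; 20;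
       22; 6; 10; 1; 14];
      [:: 36; 30; 35; 27; 2; 4; 26; 1; 5; 9; 12; 3; 31; 22; 7; 24; 11; 8; 23; 14;
       6; 17; 18; 19; 10];
      [:: 7; 36; 1; 23; 5; 15; 40; 11; 31; 4; 34; 24; 13; 29; 26; 19; 12; 21; 18;
       2; 3; 22; 8; 9; 17; 6];
      [:: 40; 9; 3; 45; 38; 29; 31; 16; 33; 11; 6; 2; 7; 4; 18; 28; 14; 22; 10;
       25; 15; 8; 5; 13; 1; 21; 19];
      [:: 49; 42; 5; 3; 28; 34; 4; 8; 38; 11; 30; 19; 16; 25; 20; 2; 10; 7; 29;
       26; 21; 12; 15; 6; 1; 23; 18; 9];
      [:: 37; 3; 6; 2; 41; 13; 36; 33; 43; 14; 17; 35; 1; 26; 27; 16; 5; 8; 4;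
       31; 18; 23; 21; 10; 24; 7; 9; 22; 19];
      [:: 46; 18; 40; 48; 16; 44; 4; 1; 9; 6; 21; 2; 28; 34; 31; 33; 19; 5; 32;
       13; 8; 23; 12; 7; 30; 11; 3; 25; 10; 14];
      [:: 50; 41; 51; 1; 13; 25; 7; 44; 17; 38; 26; 12; 42; 36; 2; 9; 6; 21; 3;
       22; 8; 5; 34; 10; 15; 27; 14; 19; 4; 16; 18];
      [:: 53; 49; 18; 45; 43; 47; 9; 10; 33; 1; 13; 32; 2; 16; 25; 42; 3; 38; 12;
       5; 7; 11; 29; 14; 4; 19; 8; 6; 28; 20; 15; 23];
      [:: 11; 14; 52; 44; 20; 13; 4; 35; 1; 50; 38; 47; 32; 28; 2; 34; 6; 39; 37;
       33; 3; 15; 7; 27; 9; 21; 8; 12; 10; 24; 5; 26; 19];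
      [:: 4; 35; 14; 56; 7; 1; 50; 48; 38; 10; 40; 42; 33; 19; 9; 32; 22; 41; 44;
       8; 2; 3; 17; 6; 28; 5; 16; 21; 12; 15; 24; 20; 25; 27];
      [:: 5; 6; 40; 41; 10; 7; 55; 57; 11; 50; 46; 9; 17; 38; 48; 8; 22; 35; 18;
       13; 29; 25; 23; 32; 16; 1; 34; 31; 2; 28; 24; 4; 15; 20; 3];
      [:: 5; 64; 16; 10; 60; 6; 8; 15; 53; 39; 49; 26; 51; 45; 40; 32; 24; 34;
       27; 30; 11; 13; 17; 3; 31; 35; 4; 2; 7; 14; 22; 19; 9; 23; 28; 1];
      [:: 2; 57; 38; 46; 58; 7; 16; 17; 52; 48; 10; 25; 5; 50; 53; 11; 12; 20; 3;
       42; 45; 26; 8; 41; 32; 30; 6; 15; 1; 4; 22; 13; 34; 21; 14; 18; 23];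
      [:: 70; 59; 12; 64; 13; 48; 32; 2; 23; 1; 44; 51; 36; 53; 9; 6; 34; 19; 29;
       7; 14; 47; 42; 10; 4; 5; 39; 22; 31; 27; 15; 20; 11; 25; 8; 26; 3; 18];
      [:: 62; 65; 7; 2; 8; 11; 57; 22; 59; 63; 54; 26; 45; 31; 25; 10; 33; 18;
       27; 50; 3; 13; 29; 38; 17; 35; 1; 9; 4; 24; 40; 37; 14; 15; 20; 5; 6;
       28; 21];
      [:: 73; 7; 43; 11; 40; 16; 59; 9; 54; 62; 10; 53; 1; 25; 14; 57; 18; 39;
       17; 50; 29; 2; 48; 34; 44; 4; 5; 33; 31; 32; 37; 22; 26; 6; 8; 19; 12;
       3; 13; 24];
      [:: 41; 70; 50; 7; 1; 8; 10; 22; 66; 55; 26; 57; 32; 56; 53; 58; 5; 14; 4;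
       39; 3; 18; 2; 42; 37; 35; 21; 13; 27; 9; 40; 44; 34; 24; 11; 19; 6; 25;
       15; 33; 16];
      [:: 15; 41; 60; 18; 71; 63; 61; 20; 37; 3; 68; 24; 2; 6; 58; 54; 7; 11; 39;
       55; 17; 8; 4; 43; 47; 51; 23; 31; 32; 10; 40; 12; 27; 5; 16; 38; 29; 9;
       25; 13; 1; 14];
      [:: 16; 7; 8; 71; 51; 65; 55; 11; 70; 60; 28; 13; 21; 41; 59; 5; 56; 54; 1;
       20; 2; 36; 24; 43; 32; 10; 6; 35; 52; 12; 37; 19; 44; 9; 34; 30; 4; 14;
       22; 38; 3; 18; 33]].

(** The lengths l = 4t + 44, 4t + 45, 4t + 46, 4t + 47. The first nest of each
family has most of the distances of one parity, in the upper half of the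
positions; the second and third ones have most of those of the other parity, in
the lower half. The pairs left over lie near the ends of these nests, and their
number is the same for all t. *)
Definition long_langford7 : seq (seq nest) :=
  [:: [:: (4, 40, (0, 15), (2, 17)); (0, 1, (2, 34), (1, 0)); (1, 17, (0, 12),
       (1, 0)); (2, 19, (4, 48), (0, 1)); (2, 27, (4, 42), (0, 1)); (2, 21,
       (4, 40), (0, 1)); (2, 20, (4, 50), (0, 1)); (6, 59, (0, 9), (0, 1));
       (2, 18, (4, 44), (0, 1)); (2, 17, (4, 46), (0, 1)); (2, 26, (4, 38),
       (0, 1)); (2, 22, (4, 36), (0, 1)); (4, 39, (4, 49), (0, 1)); (4, 36,
       (2, 24), (0, 1)); (2, 24, (2, 14), (0, 1)); (2, 25, (2, 12), (0, 1));
       (4, 35, (2, 30), (0, 1)); (1, 15, (2, 16), (0, 1)); (1, 6, (0, 10), (0,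
       1)); (1, 8, (2, 22), (0, 1)); (1, 4, (2, 28), (0, 1)); (1, 7, (2, 26),
       (0, 1)); (1, 5, (0, 7), (0, 1)); (1, 3, (0, 8), (0, 1)); (1, 10, (2,
       18), (0, 1)); (1, 9, (2, 20), (0, 1)); (1, 2, (0, 11), (0, 1)); (2, 23,
       (4, 34), (0, 1)); (4, 34, (2, 32), (0, 1)); (1, 1, (0, 13), (0, 1))];
      [:: (4, 37, (0, 13), (2, 20)); (0, 1, (2, 34), (1, 1)); (1, 16, (0, 12),
       (1, 0)); (1, 6, (2, 28), (0, 1)); (1, 5, (2, 26), (0, 1)); (1, 8, (2,
       24), (0, 1)); (1, 7, (2, 22), (0, 1)); (1, 10, (2, 20), (0, 1)); (1, 3,
       (0, 8), (0, 1)); (1, 2, (0, 7), (0, 1)); (1, 15, (2, 18), (0, 1)); (1,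
       12, (2, 16), (0, 1)); (1, 4, (0, 10), (0, 1)); (6, 59, (2, 30), (0,
       1)); (2, 17, (0, 9), (0, 1)); (2, 22, (4, 38), (0, 1)); (2, 25, (4,
       36), (0, 1)); (2, 23, (4, 40), (0, 1)); (2, 20, (4, 42), (0, 1)); (2,
       21, (4, 44), (0, 1)); (2, 18, (4, 46), (0, 1)); (2, 19, (4, 48), (0,
       1)); (2, 16, (4, 50), (0, 1)); (6, 58, (2, 32), (0, 1)); (6, 57, (0,
       11), (0, 1)); (1, 13, (2, 14), (0, 1)); (2, 24, (2, 12), (0, 1))];
      [:: (4, 39, (0, 12), (2, 21)); (0, 1, (2, 35), (1, 1)); (1, 17, (0, 11),
       (1, 0)); (1, 5, (2, 27), (0, 1)); (1, 9, (2, 25), (0, 1)); (1, 7, (2,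
       23), (0, 1)); (1, 6, (2, 29), (0, 1)); (1, 10, (2, 21), (0, 1)); (1, 3,
       (0, 8), (0, 1)); (1, 8, (0, 7), (0, 1)); (1, 2, (2, 31), (0, 1)); (1,
       12, (2, 17), (0, 1)); (1, 4, (0, 10), (0, 1)); (1, 13, (2, 15), (0,
       1)); (6, 61, (0, 9), (0, 1)); (2, 19, (2, 19), (0, 1)); (2, 17, (4,
       49), (0, 1)); (2, 23, (4, 45), (0, 1)); (2, 21, (4, 43), (0, 1)); (2,
       18, (4, 51), (0, 1)); (2, 20, (4, 47), (0, 1)); (2, 22, (4, 41), (0,
       1)); (2, 26, (4, 39), (0, 1)); (2, 25, (4, 37), (0, 1)); (6, 60, (2,
       33), (0, 1)); (2, 24, (2, 13), (0, 1)); (1, 16, (2, 11), (0, 1))];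
      [:: (4, 40, (0, 13), (2, 21)); (0, 1, (2, 36), (1, 0)); (1, 16, (0, 12),
       (1, 2)); (1, 2, (0, 11), (0, 1)); (1, 4, (0, 10), (0, 1)); (1, 3, (0,
       9), (0, 1)); (1, 5, (2, 30), (0, 1)); (1, 11, (2, 20), (0, 1)); (1, 10,
       (2, 22), (0, 1)); (1, 6, (2, 28), (0, 1)); (1, 7, (0, 8), (0, 1)); (1,
       9, (2, 24), (0, 1)); (1, 1, (0, 7), (0, 1)); (4, 37, (2, 26), (0, 1));
       (4, 36, (2, 32), (0, 1)); (2, 21, (2, 18), (0, 1)); (2, 22, (2, 16),
       (0, 1)); (2, 20, (4, 46), (0, 1)); (2, 28, (4, 44), (0, 1)); (2, 24,
       (4, 40), (0, 1)); (2, 25, (4, 42), (0, 1)); (2, 27, (4, 38), (0, 1));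
       (2, 26, (4, 36), (0, 1)); (6, 61, (2, 34), (0, 1)); (2, 23, (4, 48),
       (0, 1)); (2, 19, (4, 50), (0, 1)); (2, 18, (4, 52), (0, 1))]].

Lemma short_langford7P : all (fun l =>
  langford_check 7 (0, l) (1 < l %% 4) (sporadic 7 (nth [::] short_langford7 (l - 13))))
  (iota 13 31).
Proof. by vm_compute. Qed.

Lemma long_langford7P : all (fun r =>
  langford_check 7 (4, 44 + r) (1 < r) (nth [::] long_langford7 r)) (iota 0 4).
Proof. by vm_compute. Qed.

Lemma langford7 l : 13 <= l -> exists ps, langford 7 l (1 < l %% 4) ps.
Proof.
move=> l13; have [l44|l44] := ltnP l 44.
  have /(allP short_langford7P)/(langford_checkP 0) : l \in iota 13 31.
    by rewrite mem_iota l13 l44.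
  by rewrite /ev /= => L; eexists; exact: L.
have r4 : l %% 4 \in iota 0 4 by rewrite mem_iota ltn_pmod.
have /(langford_checkP ((l - 44) %/ 4)) := allP long_langford7P _ r4.
have -> : ev ((l - 44) %/ 4) (4, 44 + l %% 4) = l by rewrite /ev /=; lia.
by move=> L; eexists; exact: L.
Qed.

(** * Gadgets and their tails *)

(** A label of a gadget without reference to the maximal label M: a small label
is given as it is, a large one by its distance from M. Edge labels, which are
differences of labels, are recorded in the same way. *)
Definition mark : Type := (bool * nat)%type.

Definition lo (a : nat) : mark := (false, a).
Definition hi (b : nat) : mark := (true, b).

Definition place (M : nat) (p : mark) : nat := if p.1 then M - p.2 else p.2.

Definition mark_dist (p q : mark) : mark :=
  if p.1 == q.1 then lo (dist p.2 q.2) else hi (p.2 + q.2).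

(** With a hooked tail M = 3l + 18, and the label 3l + 7 = M - 11 is used by the
tail while 3l + 6 = M - 12 is the hole. Otherwise M = 3l + 19, and M - 1 is the
label 3N that does not occur. *)
Definition mark_target (hooked : bool) : seq mark :=
  map lo (iota 1 6) ++
  map hi (if hooked then rcons (iota 0 11) 12 else 0 :: iota 2 11).

(** The bound 12 keeps the labels of the gadget clear of those of the tail, which
lie between l + 7 and 3l + 6, except that a hooked tail also has M - 11. *)
Definition gadget_check (c : seq nat) (hooked : bool) (g : seq mark) : bool :=
  [&& size g == (size c).*2.+1, uniq g, head (lo 1) g == lo 0,
      all (fun p => (p.2 <= 12) && (hooked ==> (p != hi 11))) g
    & all (fun m => m \in [seq mark_dist (nth (lo 0) g p.1) (nth (lo 0) g p.2)
                          | p <- sides (code_triangles c)]) (mark_target hooked)].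

Lemma place_dist M p q : 24 <= M -> p.2 <= 12 -> q.2 <= 12 ->
  dist (place M p) (place M q) = place M (mark_dist p q).
Proof.
case: p q => [[] a] [[] b] /= M24 a12 b12;
  by rewrite /place /mark_dist /dist /=; lia.
Qed.

(** Labels of the 13 vertices of each padded code, for tails without hook. *)
Definition near_gadgets : seq (seq mark) :=
  [::
      [:: lo 0; hi 0; hi 5; lo 3; hi 9; lo 2; hi 4; lo 1; hi 10; lo 4; hi 3;
          lo 6; hi 2];
      [:: lo 0; lo 4; hi 5; lo 1; hi 7; hi 10; hi 12; lo 5; hi 2; lo 6; hi 0;
          hi 3; hi 4];
      [:: lo 0; lo 4; hi 5; lo 2; hi 8; hi 4; hi 7; lo 6; hi 0; lo 1; hi 3;
          lo 5; hi 2];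
      [:: lo 0; lo 4; hi 5; lo 2; hi 8; lo 3; lo 6; hi 3; hi 4; hi 0; hi 6;
          hi 2; hi 7];
      [:: lo 0; lo 4; hi 5; lo 7; hi 3; lo 2; hi 1; hi 0; hi 6; hi 11; hi 12;
          hi 2; hi 4];
      [:: lo 0; lo 4; hi 5; lo 2; hi 8; lo 1; hi 3; hi 7; hi 10; lo 6; hi 0;
          lo 5; hi 2];
      [:: lo 0; hi 7; hi 9; lo 4; hi 8; lo 3; hi 2; lo 1; hi 1; hi 0; hi 4;
          hi 3; hi 6];
      [:: lo 0; hi 7; hi 9; lo 3; hi 2; lo 1; hi 1; lo 2; hi 10; hi 0; hi 4;
          hi 3; hi 6];
      [:: lo 0; lo 4; hi 5; lo 7; hi 3; hi 7; hi 8; lo 2; hi 1; hi 0; hi 6;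
          hi 2; hi 4];
      [:: lo 0; lo 4; hi 5; lo 2; hi 8; hi 4; hi 7; hi 0; hi 6; lo 3; hi 1;
          lo 5; hi 2];
      [:: lo 0; lo 4; hi 5; hi 6; lo 5; lo 1; hi 11; lo 2; hi 1; hi 4; hi 7;
          hi 0; hi 2];
      [:: lo 0; lo 4; hi 5; lo 2; hi 8; lo 6; hi 2; hi 6; hi 0; lo 1; hi 1;
          hi 3; hi 4];
      [:: lo 0; lo 4; hi 5; hi 6; hi 3; lo 5; hi 7; lo 2; hi 1; hi 2; hi 4;
          lo 6; hi 0];
      [:: lo 0; lo 4; hi 5; lo 7; hi 3; lo 2; hi 1; lo 8; lo 9; hi 0; hi 6;
          hi 2; hi 4];
      [:: lo 0; lo 4; hi 5; lo 7; hi 3; hi 1; lo 2; lo 10; lo 11; hi 2; hi 4;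
          hi 0; hi 6];
      [:: lo 0; lo 4; hi 5; lo 7; hi 3; lo 8; hi 4; hi 2; lo 2; lo 1; hi 7;
          lo 6; hi 0];
      [:: lo 0; lo 4; hi 5; lo 2; hi 8; lo 1; hi 3; hi 1; hi 6; lo 6; hi 0;
          lo 9; hi 2]].

(** Labels of the 13 vertices of each padded code, for hooked tails. *)
Definition graceful_gadgets : seq (seq mark) :=
  [::
      [:: lo 0; hi 0; hi 4; lo 1; hi 2; lo 2; hi 6; hi 9; hi 12; lo 6; hi 1;
          hi 5; hi 10];
      [:: lo 0; lo 4; hi 4; lo 2; hi 8; lo 1; hi 2; lo 5; hi 0; hi 6; hi 9;
          hi 1; hi 7];
      [:: lo 0; lo 4; hi 4; lo 2; hi 8; lo 1; hi 5; lo 5; hi 0; hi 2; hi 3;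
          hi 1; hi 7];
      [:: lo 0; lo 4; hi 4; hi 6; hi 8; lo 2; hi 7; lo 1; hi 2; hi 0; hi 5;
          lo 6; hi 1];
      [:: lo 0; lo 4; hi 4; hi 8; hi 6; lo 1; hi 5; lo 6; hi 1; hi 2; hi 3;
          lo 5; hi 0];
      [:: lo 0; lo 4; hi 4; lo 2; hi 8; hi 0; lo 5; lo 1; lo 7; hi 6; hi 9;
          hi 2; hi 3];
      [:: lo 0; hi 2; lo 5; lo 4; lo 10; lo 7; hi 3; lo 3; hi 5; hi 0; hi 4;
          lo 2; hi 1];
      [:: lo 0; hi 2; lo 5; lo 2; lo 8; lo 4; lo 7; lo 1; hi 7; hi 0; hi 1;
          hi 3; hi 5];
      [:: lo 0; lo 4; hi 4; lo 2; hi 5; hi 2; hi 8; lo 7; hi 3; lo 3; hi 0;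
          lo 1; hi 1];
      [:: lo 0; lo 4; hi 4; hi 1; hi 6; lo 10; hi 2; hi 0; lo 3; lo 1; lo 2;
          hi 7; hi 9];
      [:: lo 0; hi 2; lo 5; lo 1; lo 3; lo 2; hi 4; hi 3; hi 9; lo 4; hi 8;
          hi 0; hi 1];
      [:: lo 0; lo 4; hi 4; lo 2; hi 8; lo 5; hi 1; hi 0; hi 5; lo 1; hi 6;
          hi 2; hi 3];
      [:: lo 0; lo 4; hi 4; hi 2; lo 10; lo 5; lo 7; lo 3; lo 8; hi 0; hi 3;
          lo 1; hi 1];
      [:: lo 0; lo 4; hi 4; lo 2; hi 5; hi 3; hi 8; lo 1; lo 7; hi 1; hi 2;
          lo 3; hi 0];
      [:: lo 0; lo 4; hi 4; hi 8; hi 2; lo 2; hi 3; hi 5; hi 7; lo 1; hi 1;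
          lo 3; hi 0];
      [:: lo 0; lo 4; hi 4; hi 1; hi 6; lo 5; lo 11; hi 0; hi 3; lo 1; lo 2;
          hi 7; hi 9];
      [:: lo 0; lo 4; hi 4; lo 2; hi 8; hi 0; lo 5; lo 1; lo 7; hi 3; hi 2;
          lo 3; lo 6]].

(** The row of a code c lists the labellings of c with n = 0, 1, ... additional
vanes appended, up to 18 triangles. *)
Definition small_labels : seq (seq (seq nat)) :=
  [::
     [:: [:: 0];
      [:: 0; 2; 3];
      [:: 0; 5; 7; 3; 4];
      [:: 0; 6; 10; 7; 8; 3; 5];
      [:: 0; 1; 12; 7; 10; 5; 9; 2; 8];
      [:: 0; 8; 15; 9; 14; 10; 13; 11; 12; 4; 6];
      [:: 0; 14; 19; 9; 17; 13; 16; 4; 15; 10; 12; 6; 7];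
      [:: 0; 7; 22; 14; 20; 10; 19; 16; 18; 13; 17; 11; 12; 5; 8];
      [:: 0; 23; 24; 6; 22; 10; 21; 13; 20; 17; 19; 3; 18; 5; 14; 4; 12];
      [:: 0; 17; 27; 15; 26; 12; 25; 21; 24; 5; 23; 14; 22; 19; 20; 9; 16; 4;
          6];
      [:: 0; 26; 31; 14; 29; 22; 28; 20; 27; 16; 25; 1; 24; 3; 21; 8; 19; 13;
          17; 10; 12];
      [:: 0; 3; 34; 26; 32; 19; 30; 16; 29; 4; 28; 20; 27; 15; 25; 18; 23; 21;
          22; 9; 17; 12; 14];
      [:: 0; 33; 36; 18; 35; 19; 34; 25; 32; 10; 31; 24; 30; 20; 29; 1; 28;
          22; 26; 11; 23; 14; 16; 8; 13];
      [:: 0; 16; 39; 37; 38; 31; 36; 8; 35; 6; 34; 15; 33; 30; 32; 17; 29; 4;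
          26; 14; 25; 21; 24; 13; 20; 9; 19];
      [:: 0; 16; 43; 26; 41; 31; 40; 36; 39; 5; 38; 29; 37; 22; 35; 6; 34; 21;
          32; 18; 30; 23; 25; 17; 24; 19; 20; 10; 14];
      [:: 0; 10; 46; 25; 44; 11; 43; 12; 42; 21; 41; 38; 40; 17; 39; 24; 37;
          28; 35; 29; 34; 27; 33; 16; 31; 18; 26; 9; 23; 3; 4];
      [:: 0; 29; 48; 23; 47; 41; 46; 32; 45; 26; 44; 36; 43; 12; 42; 6; 40;
          35; 39; 11; 38; 28; 37; 25; 33; 21; 31; 20; 22; 14; 17; 15; 16];
      [:: 0; 21; 51; 32; 50; 48; 49; 35; 47; 41; 46; 38; 45; 33; 44; 37; 43;
          26; 42; 4; 40; 20; 39; 10; 34; 17; 31; 27; 29; 3; 28; 15; 23; 13;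
          22];
      [:: 0; 53; 55; 32; 52; 44; 51; 41; 50; 45; 49; 29; 48; 21; 47; 24; 46;
          25; 43; 31; 42; 23; 40; 6; 39; 30; 38; 34; 37; 1; 36; 16; 28; 14;
          27; 10; 15]];
     [:: [:: 0; 5; 7; 1; 4];
      [:: 0; 6; 1; 9; 2; 8; 10];
      [:: 0; 9; 10; 5; 3; 7; 12; 8; 11];
      [:: 0; 12; 2; 1; 5; 14; 15; 8; 13; 6; 9];
      [:: 0; 1; 14; 13; 3; 4; 19; 11; 17; 9; 16; 5; 8];
      [:: 0; 3; 16; 8; 20; 2; 22; 15; 19; 11; 18; 6; 14; 9; 10];
      [:: 0; 13; 11; 5; 8; 17; 24; 14; 23; 10; 22; 15; 21; 16; 20; 18; 19];
      [:: 0; 26; 21; 3; 18; 24; 27; 11; 25; 16; 22; 2; 20; 12; 19; 4; 17; 9;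
          10];
      [:: 0; 1; 10; 19; 22; 24; 31; 23; 29; 11; 28; 8; 27; 4; 26; 12; 25; 15;
          20; 14; 16];
      [:: 0; 19; 30; 1; 29; 20; 34; 3; 32; 25; 31; 4; 27; 9; 26; 22; 24; 16;
          21; 7; 15; 12; 13];
      [:: 0; 31; 28; 7; 21; 1; 36; 4; 34; 27; 33; 11; 32; 12; 29; 19; 26; 16;
          25; 15; 23; 20; 22; 5; 18];
      [:: 0; 12; 15; 7; 37; 6; 39; 1; 38; 19; 36; 21; 35; 2; 34; 24; 31; 18;
          29; 20; 28; 23; 27; 10; 26; 13; 22];
      [:: 0; 10; 34; 39; 42; 30; 43; 33; 41; 1; 40; 20; 38; 21; 37; 5; 36; 9;
          35; 6; 28; 23; 27; 14; 25; 12; 19; 2; 17];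
      [:: 0; 30; 23; 27; 41; 44; 46; 28; 43; 1; 42; 16; 40; 33; 39; 25; 38;
          19; 37; 26; 36; 8; 35; 29; 34; 20; 32; 9; 31; 4; 21];
      [:: 0; 18; 24; 47; 5; 1; 48; 19; 46; 17; 45; 41; 44; 10; 43; 36; 40; 34;
          39; 7; 38; 12; 37; 26; 35; 21; 32; 16; 30; 8; 23; 2; 22];
      [:: 0; 39; 10; 46; 35; 33; 51; 42; 50; 26; 49; 2; 48; 38; 47; 32; 45;
          30; 44; 27; 43; 24; 41; 5; 40; 31; 37; 21; 36; 22; 34; 25; 28; 19;
          20];
      [:: 0; 10; 19; 26; 53; 2; 55; 30; 52; 5; 51; 39; 50; 7; 49; 40; 48; 41;
          47; 25; 45; 23; 44; 12; 38; 24; 37; 32; 36; 18; 35; 33; 34; 28; 31;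
          15; 29]];
     [:: [:: 4; 10; 5; 0; 8; 3; 6];
      [:: 0; 11; 12; 7; 1; 2; 9; 5; 8];
      [:: 0; 14; 3; 9; 8; 5; 1; 7; 15; 10; 12];
      [:: 0; 16; 19; 10; 6; 8; 1; 12; 17; 13; 14; 9; 11];
      [:: 0; 20; 6; 11; 7; 15; 13; 12; 22; 8; 19; 3; 18; 16; 17];
      [:: 0; 15; 16; 4; 8; 1; 6; 18; 24; 20; 23; 12; 22; 13; 21; 17; 19];
      [:: 0; 1; 26; 6; 25; 10; 16; 20; 27; 11; 23; 14; 22; 17; 21; 2; 18; 3;
          13];
      [:: 0; 25; 26; 20; 9; 23; 1; 13; 31; 6; 29; 8; 28; 17; 27; 14; 21; 15;
          19; 3; 12];
      [:: 0; 1; 16; 23; 19; 7; 12; 25; 34; 13; 32; 8; 31; 20; 30; 17; 29; 26;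
          28; 24; 27; 14; 21];
      [:: 0; 32; 22; 5; 20; 23; 9; 31; 36; 19; 35; 28; 34; 3; 33; 25; 29; 18;
          26; 17; 24; 1; 21; 2; 13];
      [:: 0; 35; 26; 4; 2; 34; 20; 32; 39; 27; 38; 3; 37; 23; 36; 18; 30; 19;
          29; 22; 28; 5; 25; 8; 24; 17; 21];
      [:: 0; 24; 31; 27; 33; 7; 29; 16; 43; 1; 41; 10; 39; 20; 38; 4; 37; 21;
          36; 23; 35; 26; 34; 19; 32; 28; 30; 14; 25];
      [:: 0; 44; 20; 25; 12; 9; 35; 17; 46; 31; 43; 37; 42; 27; 41; 10; 40;
          28; 39; 36; 38; 18; 34; 8; 33; 22; 23; 6; 21; 4; 7];
      [:: 0; 38; 40; 30; 15; 43; 18; 31; 48; 29; 47; 16; 46; 32; 45; 1; 44;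
          33; 42; 4; 41; 12; 39; 26; 36; 24; 35; 6; 34; 19; 22; 14; 21];
      [:: 0; 31; 5; 23; 40; 27; 13; 32; 51; 47; 50; 38; 49; 25; 48; 12; 46;
          35; 45; 37; 44; 22; 43; 29; 42; 1; 41; 24; 39; 16; 36; 6; 33; 28;
          30];
      [:: 0; 18; 33; 16; 29; 44; 14; 39; 55; 5; 53; 51; 52; 36; 50; 25; 49; 3;
          47; 8; 46; 28; 45; 31; 43; 20; 42; 34; 41; 19; 40; 10; 37; 6; 35; 9;
          32]];
     [:: [:: 1; 8; 0; 6; 3; 4; 10];
      [:: 0; 1; 12; 5; 10; 2; 9; 6; 8];
      [:: 0; 13; 15; 5; 6; 4; 9; 10; 14; 3; 12];
      [:: 0; 4; 19; 6; 13; 7; 2; 3; 16; 8; 14; 10; 11];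
      [:: 0; 18; 13; 9; 16; 2; 10; 12; 22; 14; 20; 4; 19; 1; 17];
      [:: 0; 21; 6; 11; 4; 2; 18; 13; 24; 9; 23; 20; 22; 1; 19; 5; 8];
      [:: 0; 23; 24; 20; 13; 4; 9; 16; 27; 17; 26; 19; 25; 18; 22; 8; 21; 12;
          14];
      [:: 0; 20; 22; 8; 2; 25; 14; 10; 31; 4; 29; 5; 28; 13; 27; 19; 26; 9;
          24; 16; 17];
      [:: 0; 30; 9; 25; 5; 32; 19; 2; 34; 24; 31; 14; 29; 1; 28; 18; 26; 3;
          22; 11; 17; 12; 16];
      [:: 0; 30; 33; 7; 24; 18; 8; 31; 36; 26; 35; 27; 34; 19; 32; 11; 29; 4;
          28; 21; 22; 12; 20; 14; 16];
      [:: 0; 24; 3; 22; 10; 25; 38; 1; 39; 28; 37; 19; 36; 8; 34; 15; 33; 7;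
          32; 27; 31; 20; 30; 23; 29; 11; 16];
      [:: 0; 24; 21; 2; 38; 23; 16; 15; 43; 33; 41; 31; 40; 1; 39; 27; 37; 18;
          35; 11; 34; 20; 32; 26; 30; 13; 29; 19; 25];
      [:: 0; 31; 35; 3; 19; 11; 34; 6; 46; 15; 44; 32; 43; 37; 42; 7; 41; 36;
          39; 25; 38; 14; 33; 21; 30; 17; 27; 18; 26; 20; 22];
      [:: 0; 6; 41; 27; 11; 12; 45; 25; 48; 7; 47; 1; 46; 34; 44; 30; 43; 15;
          42; 22; 39; 36; 38; 19; 37; 24; 32; 3; 31; 14; 26; 9; 20];
      [:: 0; 39; 22; 6; 26; 11; 13; 41; 51; 16; 50; 46; 49; 27; 48; 40; 47;
          19; 45; 32; 44; 25; 43; 36; 42; 37; 38; 30; 35; 8; 31; 15; 29; 4;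
          28];
      [:: 0; 13; 24; 38; 54; 21; 4; 46; 55; 30; 53; 42; 52; 44; 51; 12; 50;
          28; 49; 43; 48; 39; 47; 26; 45; 22; 40; 36; 37; 31; 35; 32; 34; 27;
          33; 15; 29]];
     [:: [:: 5; 8; 3; 0; 7; 6; 10];
      [:: 0; 12; 11; 2; 8; 10; 5; 7; 9];
      [:: 0; 14; 2; 1; 6; 8; 4; 9; 15; 10; 11];
      [:: 0; 13; 7; 18; 9; 2; 3; 8; 19; 14; 17; 10; 12];
      [:: 0; 4; 16; 18; 1; 11; 17; 13; 22; 2; 20; 8; 19; 5; 15];
      [:: 0; 17; 12; 4; 6; 14; 10; 15; 24; 16; 23; 8; 22; 3; 21; 19; 20];
      [:: 0; 24; 15; 6; 16; 19; 13; 25; 27; 4; 26; 12; 23; 5; 21; 1; 20; 14;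
          17];
      [:: 0; 25; 7; 24; 10; 13; 30; 27; 31; 5; 29; 16; 28; 23; 26; 20; 22; 8;
          21; 9; 19];
      [:: 0; 2; 31; 29; 22; 6; 20; 12; 34; 26; 32; 17; 30; 18; 28; 24; 25; 16;
          21; 15; 19; 8; 11];
      [:: 0; 11; 32; 34; 18; 29; 9; 24; 36; 1; 35; 4; 33; 17; 31; 27; 30; 6;
          28; 8; 26; 10; 19; 2; 15];
      [:: 0; 24; 19; 28; 2; 31; 1; 23; 39; 20; 38; 6; 37; 25; 36; 7; 35; 21;
          34; 32; 33; 15; 29; 9; 17; 10; 12];
      [:: 0; 18; 33; 29; 15; 35; 12; 24; 43; 31; 41; 28; 40; 7; 39; 30; 38; 2;
          37; 20; 36; 5; 34; 1; 27; 4; 25; 13; 22];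
      [:: 0; 14; 36; 5; 24; 26; 38; 31; 46; 4; 44; 18; 43; 37; 42; 17; 41; 1;
          39; 3; 35; 8; 34; 28; 30; 23; 29; 16; 27; 7; 20];
      [:: 0; 33; 2; 14; 38; 39; 22; 35; 48; 40; 47; 45; 46; 30; 44; 4; 43; 20;
          42; 3; 41; 9; 37; 26; 36; 18; 34; 21; 32; 23; 29; 15; 27];
      [:: 0; 41; 34; 31; 33; 2; 25; 26; 51; 22; 50; 16; 49; 47; 48; 3; 46; 18;
          45; 32; 44; 11; 42; 36; 40; 9; 39; 21; 38; 24; 37; 20; 35; 14; 19];
      [:: 0; 47; 24; 17; 26; 7; 13; 53; 55; 27; 52; 14; 51; 42; 50; 46; 49;
          31; 48; 40; 45; 18; 44; 36; 43; 12; 41; 28; 39; 22; 38; 15; 35; 1;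
          34; 19; 32]];
     [:: [:: 12; 3; 9; 1; 8; 0; 4; 10; 11];
      [:: 0; 4; 14; 11; 5; 3; 15; 12; 1; 8; 13];
      [:: 0; 2; 17; 10; 3; 4; 14; 1; 13; 6; 19; 11; 16];
      [:: 0; 5; 20; 8; 1; 2; 14; 21; 13; 9; 22; 17; 18; 10; 16];
      [:: 0; 7; 24; 17; 21; 5; 23; 18; 16; 1; 22; 12; 20; 3; 19; 9; 15];
      [:: 0; 26; 4; 13; 7; 10; 3; 18; 1; 15; 27; 11; 25; 23; 24; 5; 21; 2; 20];
      [:: 0; 25; 6; 13; 27; 31; 4; 2; 30; 15; 26; 7; 24; 20; 23; 9; 22; 5; 21;
          8; 18];
      [:: 0; 16; 21; 13; 30; 32; 22; 14; 6; 27; 34; 1; 31; 20; 29; 4; 28; 19;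
          25; 11; 23; 2; 15];
      [:: 0; 33; 3; 7; 27; 19; 15; 6; 20; 9; 36; 18; 35; 12; 34; 25; 32; 2;
          31; 23; 28; 16; 24; 10; 21];
      [:: 0; 26; 15; 35; 23; 37; 21; 6; 30; 25; 39; 20; 38; 1; 36; 29; 34; 10;
          33; 2; 32; 22; 28; 19; 27; 4; 17];
      [:: 0; 15; 40; 4; 18; 35; 5; 17; 1; 24; 43; 37; 41; 7; 39; 28; 38; 27;
          36; 31; 33; 12; 29; 20; 26; 22; 23; 8; 21];
      [:: 0; 6; 26; 22; 11; 7; 42; 21; 45; 37; 46; 8; 44; 2; 43; 27; 40; 18;
          39; 30; 34; 23; 33; 17; 32; 12; 31; 28; 29; 3; 25];
      [:: 0; 32; 13; 43; 14; 48; 3; 5; 27; 6; 47; 16; 46; 34; 44; 15; 42; 23;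
          40; 25; 39; 37; 38; 28; 36; 26; 35; 31; 33; 4; 24; 7; 12];
      [:: 0; 51; 11; 6; 20; 41; 44; 25; 13; 26; 50; 22; 49; 42; 48; 30; 47;
          10; 46; 8; 43; 1; 39; 33; 37; 19; 34; 7; 32; 9; 29; 21; 23; 5; 18];
      [:: 0; 2; 29; 38; 19; 30; 12; 7; 35; 41; 55; 46; 53; 31; 52; 43; 51; 37;
          50; 40; 49; 32; 48; 25; 47; 10; 45; 6; 44; 39; 42; 33; 34; 11; 26;
          20; 24]];
     [:: [:: 6; 12; 10; 4; 1; 11; 2; 5; 0];
      [:: 0; 14; 10; 3; 6; 1; 13; 7; 12; 9; 15];
      [:: 0; 17; 15; 3; 13; 8; 5; 10; 9; 6; 19; 11; 16];
      [:: 0; 19; 15; 5; 21; 7; 1; 10; 9; 17; 22; 13; 20; 8; 11];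
      [:: 0; 3; 17; 5; 13; 21; 15; 8; 19; 9; 24; 4; 23; 1; 22; 7; 20];
      [:: 0; 25; 27; 10; 11; 19; 6; 9; 20; 22; 26; 17; 24; 3; 23; 12; 21; 8;
          18];
      [:: 0; 28; 24; 15; 12; 1; 2; 14; 16; 21; 31; 20; 29; 6; 25; 8; 23; 17;
          22; 7; 18];
      [:: 0; 28; 3; 9; 19; 14; 20; 6; 7; 23; 34; 12; 32; 16; 31; 26; 30; 27;
          29; 17; 24; 5; 18];
      [:: 0; 24; 29; 1; 10; 7; 32; 21; 22; 4; 36; 16; 35; 27; 34; 12; 33; 13;
          31; 20; 30; 6; 28; 15; 26];
      [:: 0; 39; 25; 28; 10; 29; 2; 22; 16; 31; 38; 24; 36; 26; 35; 19; 34;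
          20; 33; 4; 32; 8; 30; 5; 21; 1; 3];
      [:: 0; 10; 35; 3; 7; 39; 25; 41; 28; 2; 43; 1; 40; 21; 38; 11; 37; 16;
          36; 22; 34; 5; 33; 9; 32; 24; 30; 8; 27];
      [:: 0; 9; 46; 35; 32; 24; 14; 33; 13; 11; 44; 8; 43; 40; 42; 27; 41; 7;
          39; 22; 38; 19; 36; 21; 34; 25; 31; 12; 30; 28; 29];
      [:: 0; 43; 12; 29; 21; 15; 17; 9; 5; 6; 48; 46; 47; 10; 45; 33; 44; 32;
          41; 25; 40; 20; 39; 16; 37; 7; 36; 13; 30; 24; 27; 18; 23];
      [:: 0; 32; 7; 12; 42; 10; 15; 3; 45; 39; 51; 27; 50; 43; 49; 14; 48; 36;
          47; 1; 46; 16; 44; 4; 41; 19; 40; 35; 38; 2; 33; 18; 26; 9; 24];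
      [:: 0; 55; 10; 9; 42; 19; 25; 39; 16; 11; 53; 34; 52; 31; 51; 41; 50;
          28; 49; 26; 48; 43; 47; 37; 44; 32; 40; 35; 38; 17; 29; 2; 27; 5;
          24; 14; 15]];
     [:: [:: 7; 0; 11; 6; 5; 3; 12; 9; 1];
      [:: 0; 14; 10; 7; 6; 8; 3; 13; 1; 2; 15];
      [:: 0; 19; 15; 3; 8; 5; 2; 7; 16; 6; 13; 10; 12];
      [:: 0; 20; 2; 8; 13; 7; 3; 21; 5; 14; 22; 6; 15; 10; 11];
      [:: 0; 24; 10; 5; 13; 6; 18; 12; 17; 20; 23; 9; 22; 4; 21; 15; 16];
      [:: 0; 22; 2; 5; 17; 9; 18; 10; 21; 6; 27; 23; 26; 7; 25; 14; 24; 1; 16];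
      [:: 0; 23; 21; 30; 19; 14; 8; 9; 1; 17; 31; 16; 29; 10; 28; 26; 27; 22;
          25; 5; 24];
      [:: 0; 32; 20; 17; 21; 7; 13; 10; 28; 31; 34; 9; 30; 1; 29; 14; 27; 24;
          26; 16; 23; 5; 22];
      [:: 0; 24; 32; 15; 22; 7; 6; 16; 10; 23; 36; 30; 35; 14; 34; 21; 33; 4;
          31; 19; 29; 3; 28; 11; 26];
      [:: 0; 31; 36; 6; 17; 21; 12; 14; 38; 1; 39; 3; 37; 18; 35; 27; 33; 20;
          32; 26; 30; 8; 29; 15; 28; 7; 23];
      [:: 0; 41; 31; 4; 6; 13; 19; 40; 35; 3; 43; 26; 39; 14; 38; 20; 36; 23;
          34; 21; 33; 17; 32; 29; 30; 8; 27; 7; 25];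
      [:: 0; 3; 7; 17; 34; 21; 31; 22; 45; 6; 46; 32; 44; 35; 43; 13; 42; 30;
          41; 19; 39; 16; 37; 2; 36; 24; 33; 5; 27; 25; 26];
      [:: 0; 26; 36; 23; 12; 17; 24; 1; 20; 5; 48; 15; 47; 25; 46; 22; 45; 27;
          44; 30; 42; 40; 41; 31; 39; 18; 38; 13; 37; 6; 34; 29; 33];
      [:: 0; 47; 20; 39; 8; 22; 5; 17; 26; 33; 51; 40; 50; 35; 49; 43; 48; 34;
          46; 44; 45; 15; 41; 16; 38; 13; 37; 29; 36; 28; 32; 11; 30; 21; 23];
      [:: 0; 44; 38; 21; 54; 22; 37; 10; 40; 46; 55; 29; 53; 51; 52; 42; 50;
          45; 49; 11; 48; 26; 47; 3; 43; 25; 41; 27; 39; 31; 36; 18; 35; 14;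
          34; 13; 32]];
     [:: [:: 1; 12; 4; 7; 0; 2; 3; 11; 5];
      [:: 0; 14; 3; 5; 6; 2; 9; 1; 11; 13; 15];
      [:: 0; 14; 19; 5; 15; 3; 11; 12; 18; 2; 17; 4; 16];
      [:: 0; 20; 8; 1; 19; 10; 4; 12; 14; 15; 22; 3; 17; 5; 9];
      [:: 0; 22; 14; 2; 4; 19; 3; 6; 11; 17; 24; 10; 23; 15; 21; 1; 12];
      [:: 0; 26; 18; 3; 6; 14; 16; 19; 2; 21; 27; 11; 25; 5; 24; 15; 22; 4;
          13];
      [:: 0; 23; 8; 1; 5; 13; 22; 26; 21; 12; 31; 16; 29; 2; 28; 6; 27; 17;
          24; 11; 14];
      [:: 0; 6; 26; 2; 17; 19; 20; 25; 18; 32; 34; 22; 31; 5; 30; 12; 29; 10;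
          28; 8; 27; 21; 24];
      [:: 0; 6; 34; 16; 29; 18; 14; 32; 5; 19; 36; 3; 35; 15; 33; 22; 31; 1;
          30; 24; 26; 20; 25; 7; 21];
      [:: 0; 30; 3; 22; 21; 10; 36; 26; 8; 29; 39; 2; 38; 15; 37; 24; 35; 13;
          34; 17; 33; 25; 32; 19; 31; 23; 28];
      [:: 0; 39; 11; 26; 38; 19; 9; 30; 5; 37; 43; 32; 41; 2; 40; 22; 36; 27;
          35; 15; 34; 17; 33; 24; 31; 3; 29; 18; 23];
      [:: 0; 38; 21; 2; 1; 18; 20; 37; 43; 3; 46; 25; 44; 28; 42; 33; 40; 31;
          39; 23; 34; 27; 32; 26; 30; 16; 29; 15; 24; 12; 22];
      [:: 0; 11; 38; 24; 2; 6; 35; 10; 31; 12; 48; 46; 47; 19; 45; 16; 44; 37;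
          43; 40; 42; 23; 41; 4; 39; 3; 34; 25; 33; 17; 32; 20; 30];
      [:: 0; 30; 39; 23; 7; 16; 22; 41; 43; 27; 51; 28; 50; 32; 49; 19; 48; 4;
          47; 34; 46; 35; 45; 33; 44; 1; 42; 37; 40; 25; 38; 15; 36; 5; 31];
      [:: 0; 49; 33; 45; 9; 46; 31; 21; 13; 35; 55; 7; 53; 43; 52; 23; 51; 39;
          50; 19; 48; 2; 47; 14; 44; 41; 42; 25; 38; 6; 37; 22; 34; 17; 27; 5;
          26]];
     [:: [:: 0; 13; 11; 9; 3; 14; 6; 15; 12; 1; 10];
      [:: 0; 19; 10; 4; 18; 7; 11; 6; 17; 1; 8; 13; 16];
      [:: 0; 19; 5; 3; 7; 16; 6; 18; 17; 12; 10; 15; 22; 11; 20];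
      [:: 0; 21; 11; 1; 14; 5; 4; 12; 9; 6; 20; 22; 24; 18; 23; 15; 19];
      [:: 0; 20; 11; 13; 16; 15; 3; 23; 24; 2; 21; 14; 27; 18; 26; 10; 25; 6;
          22];
      [:: 0; 26; 22; 9; 11; 1; 21; 14; 8; 2; 5; 18; 31; 19; 29; 7; 28; 16; 27;
          23; 24];
      [:: 0; 4; 16; 15; 33; 17; 3; 24; 32; 7; 5; 27; 34; 26; 31; 9; 30; 6; 28;
          10; 25; 20; 23];
      [:: 0; 14; 26; 9; 29; 15; 24; 36; 23; 6; 30; 28; 35; 16; 34; 11; 33; 3;
          32; 27; 31; 17; 25; 19; 21];
      [:: 0; 2; 16; 12; 20; 22; 26; 38; 33; 3; 25; 36; 39; 11; 37; 9; 34; 17;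
          32; 19; 31; 7; 30; 28; 29; 21; 27];
      [:: 0; 41; 24; 9; 12; 1; 2; 26; 33; 7; 20; 25; 43; 28; 38; 21; 37; 34;
          36; 15; 35; 27; 31; 22; 30; 11; 23; 5; 14];
      [:: 0; 11; 25; 44; 32; 37; 40; 36; 5; 14; 23; 2; 46; 6; 43; 10; 42; 1;
          41; 16; 39; 8; 38; 18; 35; 19; 34; 24; 28; 20; 27];
      [:: 0; 8; 48; 38; 24; 29; 30; 7; 34; 22; 40; 43; 47; 26; 46; 32; 45; 42;
          44; 3; 41; 10; 39; 25; 37; 31; 36; 11; 35; 19; 28; 17; 23];
      [:: 0; 22; 47; 45; 28; 7; 19; 34; 50; 14; 41; 30; 51; 39; 49; 29; 48; 1;
          46; 31; 44; 2; 43; 4; 42; 35; 40; 26; 37; 8; 36; 24; 33; 18; 32];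
      [:: 0; 52; 31; 4; 13; 27; 19; 50; 20; 10; 23; 32; 55; 6; 53; 41; 51; 35;
          49; 44; 46; 28; 45; 42; 43; 34; 38; 18; 37; 24; 36; 26; 29; 15; 22;
          5; 16]];
     [:: [:: 11; 12; 0; 2; 8; 9; 7; 10; 5];
      [:: 0; 14; 3; 1; 10; 4; 9; 11; 13; 8; 15];
      [:: 0; 15; 9; 1; 5; 14; 17; 18; 2; 12; 19; 11; 13];
      [:: 0; 15; 2; 19; 14; 21; 11; 8; 1; 16; 22; 12; 20; 3; 17];
      [:: 0; 17; 19; 2; 1; 10; 5; 6; 13; 18; 24; 20; 23; 12; 22; 8; 21];
      [:: 0; 3; 19; 2; 14; 11; 6; 20; 22; 21; 27; 4; 26; 15; 25; 17; 24; 9;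
          23];
      [:: 0; 7; 29; 3; 12; 6; 16; 23; 17; 19; 31; 27; 28; 15; 26; 8; 25; 21;
          24; 2; 18];
      [:: 0; 26; 15; 20; 13; 18; 1; 30; 2; 4; 34; 24; 32; 12; 31; 9; 29; 25;
          27; 22; 23; 16; 21];
      [:: 0; 31; 4; 7; 18; 13; 5; 2; 32; 20; 36; 3; 35; 22; 34; 15; 33; 19;
          29; 26; 28; 17; 23; 14; 21];
      [:: 0; 11; 33; 35; 17; 37; 3; 14; 4; 2; 39; 25; 38; 1; 36; 29; 32; 16;
          28; 20; 27; 9; 26; 15; 23; 5; 19];
      [:: 0; 23; 29; 27; 18; 1; 2; 12; 37; 36; 43; 30; 41; 3; 40; 31; 39; 20;
          38; 21; 35; 22; 34; 17; 33; 19; 32; 24; 26];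
      [:: 0; 31; 38; 19; 45; 21; 10; 28; 6; 2; 46; 25; 43; 41; 42; 36; 40; 34;
          39; 16; 37; 20; 35; 23; 33; 29; 32; 24; 30; 8; 27];
      [:: 0; 16; 47; 34; 5; 6; 38; 30; 36; 25; 48; 10; 46; 33; 45; 14; 44; 24;
          43; 8; 42; 27; 40; 1; 39; 22; 37; 28; 35; 21; 26; 17; 20];
      [:: 0; 11; 35; 42; 30; 49; 2; 17; 10; 21; 51; 1; 50; 40; 48; 29; 46; 3;
          45; 38; 44; 15; 43; 4; 41; 5; 39; 23; 36; 18; 27; 16; 26; 20; 22];
      [:: 0; 31; 34; 42; 1; 48; 54; 6; 29; 46; 55; 37; 53; 33; 52; 43; 51; 2;
          50; 25; 49; 5; 47; 35; 45; 15; 44; 28; 40; 32; 39; 17; 38; 26; 27;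
          18; 22]];
     [:: [:: 0; 13; 15; 4; 5; 3; 10; 11; 14; 7; 1];
      [:: 0; 16; 17; 8; 14; 7; 4; 19; 12; 10; 5; 11; 15];
      [:: 0; 18; 17; 3; 14; 4; 12; 19; 22; 9; 21; 6; 20; 7; 16];
      [:: 0; 13; 22; 17; 6; 2; 14; 18; 21; 3; 20; 23; 24; 5; 19; 10; 16];
      [:: 0; 3; 24; 7; 1; 5; 4; 27; 18; 2; 10; 14; 26; 13; 23; 15; 22; 11; 16];
      [:: 0; 10; 14; 30; 3; 23; 2; 5; 24; 22; 20; 8; 31; 11; 29; 6; 28; 25;
          26; 13; 16];
      [:: 0; 14; 32; 29; 6; 13; 10; 26; 2; 33; 16; 28; 34; 27; 31; 1; 30; 12;
          25; 5; 21; 11; 20];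
      [:: 0; 35; 19; 1; 15; 17; 8; 28; 21; 4; 10; 32; 36; 25; 33; 30; 31; 26;
          29; 12; 27; 13; 23; 5; 22];
      [:: 0; 1; 13; 28; 31; 24; 8; 33; 39; 9; 7; 10; 38; 15; 37; 19; 36; 4;
          35; 20; 34; 23; 32; 21; 29; 18; 25];
      [:: 0; 39; 7; 10; 31; 17; 29; 3; 26; 41; 21; 2; 43; 4; 40; 6; 37; 19;
          35; 33; 34; 25; 30; 11; 28; 14; 27; 9; 24];
      [:: 0; 39; 27; 4; 13; 31; 41; 43; 18; 6; 35; 16; 46; 24; 44; 1; 42; 34;
          40; 7; 38; 23; 36; 28; 33; 21; 32; 19; 22; 15; 17];
      [:: 0; 43; 39; 24; 37; 30; 5; 33; 15; 25; 45; 32; 48; 23; 47; 1; 46; 27;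
          44; 7; 42; 11; 41; 3; 40; 10; 38; 22; 36; 2; 31; 21; 26];
      [:: 0; 20; 44; 9; 49; 3; 36; 7; 23; 26; 39; 42; 51; 1; 50; 12; 48; 10;
          47; 15; 46; 6; 45; 18; 43; 34; 38; 21; 35; 27; 30; 2; 28; 17; 22];
      [:: 0; 20; 24; 25; 17; 6; 34; 39; 45; 2; 27; 42; 55; 15; 53; 21; 52; 29;
          51; 23; 50; 40; 49; 46; 48; 36; 47; 30; 44; 26; 43; 7; 41; 16; 35;
          1; 33]];
     [:: [:: 7; 2; 8; 12; 9; 10; 1; 4; 0];
      [:: 0; 15; 11; 3; 10; 5; 13; 12; 6; 1; 14];
      [:: 0; 15; 7; 6; 17; 12; 2; 1; 18; 3; 19; 13; 14];
      [:: 0; 20; 1; 4; 11; 19; 15; 10; 2; 12; 22; 13; 18; 3; 17];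
      [:: 0; 23; 16; 2; 1; 15; 12; 21; 19; 9; 24; 8; 20; 4; 18; 5; 11];
      [:: 0; 9; 21; 2; 17; 24; 6; 12; 26; 1; 27; 23; 25; 3; 20; 13; 19; 11;
          16];
      [:: 0; 27; 2; 6; 10; 26; 20; 11; 22; 9; 31; 3; 29; 13; 28; 23; 24; 12;
          19; 8; 18];
      [:: 0; 16; 20; 8; 18; 23; 2; 25; 1; 22; 34; 31; 32; 5; 30; 11; 29; 19;
          28; 14; 27; 3; 26];
      [:: 0; 7; 22; 34; 1; 6; 9; 14; 10; 2; 36; 19; 35; 18; 32; 21; 31; 29;
          30; 17; 26; 12; 23; 8; 13];
      [:: 0; 35; 18; 30; 7; 11; 38; 20; 4; 1; 39; 24; 37; 6; 36; 14; 34; 31;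
          33; 21; 32; 25; 29; 15; 22; 9; 12];
      [:: 0; 25; 15; 30; 16; 11; 7; 37; 2; 32; 43; 33; 41; 3; 40; 26; 39; 21;
          38; 20; 36; 12; 34; 1; 31; 27; 29; 18; 24];
      [:: 0; 36; 22; 18; 33; 7; 6; 38; 11; 8; 46; 13; 44; 9; 43; 32; 42; 24;
          41; 19; 40; 23; 39; 4; 37; 29; 35; 25; 30; 2; 28];
      [:: 0; 18; 21; 37; 46; 43; 5; 11; 26; 40; 48; 1; 47; 2; 45; 30; 44; 25;
          42; 4; 41; 27; 39; 20; 36; 22; 35; 29; 34; 10; 33; 24; 31];
      [:: 0; 37; 16; 28; 25; 35; 6; 3; 39; 27; 51; 46; 50; 10; 49; 20; 48; 42;
          47; 44; 45; 8; 43; 23; 41; 14; 40; 32; 38; 15; 34; 31; 33; 13; 30];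
      [:: 0; 25; 9; 4; 12; 43; 21; 40; 7; 45; 55; 27; 53; 5; 52; 32; 51; 35;
          50; 37; 49; 41; 48; 28; 46; 1; 44; 2; 42; 24; 38; 30; 34; 11; 31;
          23; 29]];
     [:: [:: 7; 12; 0; 1; 4; 2; 11; 10; 6];
      [:: 0; 1; 14; 13; 3; 9; 2; 11; 8; 6; 15];
      [:: 0; 16; 6; 7; 14; 18; 10; 15; 1; 4; 19; 12; 17];
      [:: 0; 20; 2; 11; 21; 6; 18; 10; 4; 14; 22; 15; 19; 3; 16];
      [:: 0; 23; 10; 1; 22; 13; 8; 6; 4; 20; 24; 11; 19; 3; 17; 9; 15];
      [:: 0; 27; 16; 2; 9; 21; 8; 1; 18; 5; 26; 23; 24; 20; 22; 12; 15; 10;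
          14];
      [:: 0; 24; 28; 15; 1; 22; 30; 13; 14; 25; 31; 18; 29; 5; 27; 16; 26; 19;
          21; 17; 20];
      [:: 0; 19; 34; 6; 22; 15; 33; 12; 23; 28; 32; 7; 31; 8; 30; 17; 29; 21;
          26; 2; 25; 14; 20];
      [:: 0; 33; 21; 13; 30; 23; 22; 8; 15; 28; 36; 16; 35; 4; 34; 27; 32; 18;
          31; 6; 29; 24; 26; 11; 25];
      [:: 0; 22; 27; 6; 26; 32; 13; 9; 18; 24; 39; 28; 38; 36; 37; 3; 35; 21;
          34; 31; 33; 12; 30; 23; 29; 14; 25];
      [:: 0; 38; 14; 16; 5; 21; 24; 22; 34; 18; 43; 28; 41; 19; 40; 23; 39; 7;
          37; 2; 36; 20; 35; 26; 32; 27; 31; 9; 10];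
      [:: 0; 40; 23; 18; 9; 30; 45; 27; 33; 16; 46; 19; 44; 29; 43; 34; 42;
          28; 41; 37; 39; 5; 38; 10; 36; 3; 35; 20; 21; 7; 11];
      [:: 0; 41; 19; 45; 25; 9; 2; 42; 30; 6; 48; 29; 47; 1; 46; 23; 44; 10;
          40; 14; 39; 11; 38; 34; 37; 26; 35; 31; 33; 24; 32; 13; 28];
      [:: 0; 22; 37; 13; 40; 26; 42; 28; 14; 31; 51; 11; 50; 6; 49; 25; 48;
          17; 47; 4; 46; 7; 45; 8; 44; 1; 41; 32; 35; 24; 34; 5; 33; 19; 21];
      [:: 0; 8; 37; 50; 11; 12; 27; 24; 43; 28; 55; 49; 53; 30; 52; 1; 51; 36;
          48; 40; 47; 41; 46; 2; 45; 26; 44; 21; 35; 10; 34; 16; 33; 25; 31;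
          9; 20]];
     [:: [:: 6; 2; 9; 11; 3; 0; 5; 12; 10];
      [:: 0; 13; 8; 10; 4; 14; 3; 2; 12; 1; 15];
      [:: 0; 19; 16; 2; 14; 15; 17; 1; 7; 4; 11; 9; 10];
      [:: 0; 22; 15; 6; 18; 3; 16; 21; 4; 11; 20; 14; 19; 2; 8];
      [:: 0; 22; 18; 1; 9; 6; 21; 13; 15; 14; 24; 17; 23; 16; 19; 11; 12];
      [:: 0; 24; 10; 19; 8; 13; 6; 5; 25; 2; 27; 17; 26; 4; 23; 21; 22; 3; 18];
      [:: 0; 28; 2; 3; 4; 8; 24; 20; 5; 23; 31; 19; 29; 7; 27; 9; 22; 14; 18;
          6; 17];
      [:: 0; 31; 32; 7; 9; 4; 18; 33; 29; 26; 34; 12; 30; 15; 28; 20; 27; 17;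
          23; 16; 21; 10; 19];
      [:: 0; 6; 17; 2; 33; 23; 14; 31; 7; 22; 36; 15; 35; 1; 34; 25; 32; 28;
          30; 19; 29; 3; 26; 13; 18];
      [:: 0; 21; 12; 34; 16; 9; 7; 15; 29; 28; 39; 23; 38; 33; 37; 17; 36; 1;
          35; 3; 32; 24; 31; 22; 30; 10; 26];
      [:: 0; 16; 28; 40; 31; 10; 11; 12; 30; 3; 43; 22; 41; 5; 39; 7; 38; 26;
          37; 4; 36; 21; 35; 27; 33; 17; 25; 13; 23];
      [:: 0; 43; 39; 35; 23; 9; 2; 33; 15; 25; 46; 42; 44; 36; 41; 31; 40; 3;
          38; 22; 37; 11; 34; 19; 32; 14; 30; 28; 29; 17; 27];
      [:: 0; 13; 8; 38; 36; 7; 45; 22; 46; 3; 48; 1; 47; 30; 44; 26; 43; 32;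
          42; 21; 41; 4; 40; 28; 37; 19; 35; 12; 34; 6; 33; 11; 29];
      [:: 0; 12; 46; 50; 7; 39; 15; 16; 18; 1; 51; 9; 49; 20; 48; 44; 47; 6;
          45; 27; 42; 31; 41; 30; 37; 19; 36; 25; 33; 14; 32; 13; 29; 22; 26];
      [:: 0; 18; 26; 12; 47; 10; 32; 9; 46; 48; 55; 34; 53; 5; 52; 27; 51; 39;
          50; 3; 49; 13; 45; 30; 44; 28; 43; 38; 42; 31; 41; 23; 40; 21; 33;
          16; 25]];
     [:: [:: 0; 14; 5; 1; 4; 2; 13; 15; 8; 9; 11];
      [:: 0; 12; 13; 18; 10; 1; 11; 19; 3; 15; 4; 9; 14];
      [:: 0; 18; 13; 21; 1; 15; 17; 19; 8; 5; 4; 12; 22; 9; 16];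
      [:: 0; 20; 14; 9; 7; 1; 10; 24; 19; 2; 12; 16; 23; 17; 21; 15; 18];
      [:: 0; 14; 18; 8; 3; 5; 20; 24; 17; 2; 15; 19; 27; 10; 26; 23; 25; 1;
          21];
      [:: 0; 9; 31; 4; 21; 14; 25; 26; 24; 8; 22; 23; 29; 3; 28; 19; 27; 7;
          20; 1; 16];
      [:: 0; 34; 22; 10; 23; 24; 33; 29; 31; 12; 4; 27; 32; 26; 30; 21; 28;
          19; 20; 15; 18; 6; 16];
      [:: 0; 3; 19; 28; 10; 7; 13; 34; 1; 17; 4; 8; 36; 24; 35; 22; 32; 5; 31;
          20; 29; 23; 27; 2; 14];
      [:: 0; 23; 39; 14; 1; 7; 33; 17; 11; 3; 2; 20; 38; 4; 37; 24; 36; 25;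
          35; 31; 34; 27; 32; 28; 30; 21; 29];
      [:: 0; 1; 30; 17; 25; 40; 29; 36; 27; 34; 19; 3; 43; 7; 41; 14; 39; 33;
          38; 18; 37; 13; 35; 28; 32; 21; 31; 6; 26];
      [:: 0; 16; 6; 1; 41; 4; 27; 42; 13; 20; 3; 38; 46; 24; 44; 2; 43; 30;
          37; 9; 36; 34; 35; 5; 33; 21; 32; 19; 31; 14; 18];
      [:: 0; 32; 18; 36; 30; 15; 2; 9; 45; 31; 19; 28; 48; 44; 47; 29; 46; 27;
          43; 23; 42; 1; 41; 24; 39; 7; 38; 11; 37; 5; 35; 25; 33];
      [:: 0; 38; 44; 31; 22; 1; 3; 19; 33; 8; 16; 27; 51; 45; 50; 26; 49; 36;
          48; 34; 47; 29; 46; 25; 43; 10; 42; 21; 41; 39; 40; 15; 37; 4; 35];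
      [:: 0; 50; 33; 37; 28; 32; 1; 23; 29; 13; 51; 12; 55; 2; 53; 49; 52; 11;
          48; 15; 47; 25; 46; 27; 45; 24; 44; 34; 42; 40; 41; 35; 39; 16; 30;
          19; 26]];
     [:: [:: 0; 15; 16; 5; 9; 19; 7; 10; 8; 17; 3; 12; 4];
      [:: 0; 12; 17; 13; 9; 7; 22; 5; 21; 20; 11; 14; 1; 10; 18];
      [:: 0; 1; 14; 21; 6; 3; 12; 13; 19; 24; 7; 16; 5; 2; 23; 18; 22];
      [:: 0; 26; 16; 12; 8; 15; 3; 4; 9; 23; 24; 14; 1; 20; 27; 17; 25; 19;
          21];
      [:: 0; 2; 21; 8; 16; 23; 3; 12; 30; 13; 25; 4; 28; 27; 31; 1; 29; 10;
          26; 5; 22];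
      [:: 0; 25; 22; 10; 14; 32; 12; 1; 8; 21; 19; 31; 5; 28; 34; 29; 30; 13;
          27; 18; 23; 9; 17];
      [:: 0; 17; 32; 1; 30; 9; 33; 29; 4; 11; 19; 7; 25; 6; 36; 28; 35; 31;
          34; 26; 27; 2; 23; 10; 22];
      [:: 0; 34; 9; 16; 13; 26; 19; 15; 2; 36; 38; 5; 35; 4; 39; 29; 37; 17;
          33; 10; 32; 23; 28; 12; 27; 14; 20];
      [:: 0; 22; 6; 9; 30; 37; 35; 7; 8; 4; 11; 31; 16; 19; 43; 32; 41; 23;
          40; 25; 39; 20; 38; 26; 36; 3; 34; 28; 33];
      [:: 0; 42; 27; 31; 6; 16; 44; 33; 24; 34; 37; 1; 32; 40; 46; 19; 43; 21;
          41; 7; 39; 26; 38; 22; 35; 29; 30; 18; 23; 10; 14];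
      [:: 0; 17; 14; 43; 28; 30; 9; 46; 6; 2; 34; 22; 40; 5; 48; 1; 47; 39;
          45; 36; 44; 29; 42; 19; 41; 25; 37; 7; 35; 23; 33; 27; 31];
      [:: 0; 22; 39; 41; 7; 27; 13; 6; 15; 5; 28; 40; 30; 43; 51; 24; 50; 48;
          49; 18; 47; 16; 46; 4; 45; 37; 44; 2; 42; 32; 38; 33; 36; 11; 31];
      [:: 0; 43; 17; 13; 20; 38; 40; 35; 10; 4; 18; 19; 54; 34; 55; 33; 53;
          39; 52; 42; 51; 8; 49; 16; 48; 11; 47; 27; 46; 1; 45; 31; 37; 24;
          29; 12; 22]]].


(** Six triangles are needed to use up the eighteen labels that a tail of defect 7
leaves. *)
Definition pad_code (c : seq nat) : seq nat := c ++ nseq (6 - size c) 0.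

Lemma gadgets_ok : all (fun i =>
  let c := nth [::] cactus_codes i in
  [&& size c <= 6, size (pad_code c) == 6, wf_code c, wf_code (pad_code c),
      gadget_check (pad_code c) false (nth [::] near_gadgets i)
    & gadget_check (pad_code c) true (nth [::] graceful_gadgets i)])
  (iota 0 (size cactus_codes)).
Proof. by vm_compute. Qed.

Lemma mem_cactus_codes (c : seq nat) : c \in cactus_codes ->
  exists2 i, i \in iota 0 (size cactus_codes) & c = nth [::] cactus_codes i.
Proof.
move=> cc; exists (index c cactus_codes); last by rewrite nth_index.
by rewrite mem_iota index_mem.
Qed.

Definition small_check (s lab : seq nat) : bool :=
  [&& wf_code s, size lab == (size s).*2.+1, uniq lab,
      all (fun k => k <= top_label (size s)) lab
    & all (fun k => k \in labels_of (label_triangles s lab [::])) (target (size s))].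

Lemma small_labels_ok : all (fun i =>
  let c := nth [::] cactus_codes i in
  all (fun n => small_check (c ++ nseq n 0) (nth [::] (nth [::] small_labels i) n))
    (iota 0 (19 - size c))) (iota 0 (size cactus_codes)).
Proof. by vm_compute. Qed.

(** All vanes are absorbed into the code, so that each case is a computation. *)
Lemma small_graceful (G : sgraph) (c : seq nat) n :
  c \in cactus_codes -> coded G c n -> size c + n <= 18 ->
  graceful G \/ near_graceful G.
Proof.
move=> /mem_cactus_codes[i iI ->] cG le18.
have /and5P[_ _ wf _ _] := allP gadgets_ok i iI.
set c' := nth _ _ _ in cG le18 wf *.
have nI : n \in iota 0 (19 - size c') by rewrite mem_iota add0n leq0n /=; lia.
have /and5P[wf' /eqP sl ul /allP le_l /allP sub] :=
  allP (allP small_labels_ok i iI) n nI.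
have sN : size (c' ++ nseq n 0) + 0 = size (c' ++ nseq n 0) by rewrite addn0.
apply: (coded_graceful (qs := [::]) wf' _ sl (erefl _)).
- by apply: coded_absorbn.
- by rewrite cats0.
- by move=> k; rewrite cats0 addn0; apply: le_l.
by rewrite addn0; apply: sub.
Qed.

Section GadgetTail.

Variables (c : seq nat) (g : seq mark) (l : nat) (hooked : bool).
Variable ps : seq (nat * nat).
Hypotheses (wf : wf_code c) (c6 : size c = 6) (l13 : 13 <= l).
Hypotheses (gC : gadget_check c hooked g) (psL : langford 7 l hooked ps).

Let M : nat := if hooked then 3 * l + 18 else 3 * l + 19.
Let shift (k : nat) : nat := k + (l + 6).
Let lab : seq nat := map (place M) g.
Let qs : seq (nat * nat) := map (pair_map shift) ps.

Lemma place_inj : {in g &, injective (place M)}.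
Proof.
have /and5P[_ _ _ /allP gok _] := gC.
move=> [b a] [b' a'] /gok/andP[/= h _] /gok/andP[/= h' _]; clear -l13 h h'.
by rewrite /place /M /=; case: b; case: b'; case: hooked => E; try (congr pair; lia); lia.
Qed.

(** Two lists of the same size, one duplicate-free and contained in the other. *)
Lemma langford_pairs_uniq :
  uniq (unpair ps) /\ langford_positions l hooked =i unpair ps.
Proof.
have [sp pos _] := psL; have upos := uniq_langford_positions l hooked.
have sz : size (unpair ps) <= size (langford_positions l hooked).
  by rewrite size_unpair sp size_langford_positions // (leq_trans _ l13).
split; first exact: leq_size_uniq upos pos sz.
exact: (uniq_min_size upos pos sz).2.
Qed.

Lemma tail_range k : k \in unpair qs -> [/\ 12 < k, k <= M &
  if hooked then (k <= 3 * l + 5) || (k == 3 * l + 7) else k <= 3 * l + 6].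
Proof.
rewrite -map_unpair => /mapP[j]; rewrite -langford_pairs_uniq.2 => jpos ->.
move: jpos; clear -l13; rewrite /langford_positions /shift /M.
by case: hooked; rewrite ?mem_rcons ?in_cons mem_iota => H; split; lia.
Qed.

Lemma gadget_range k : k \in lab -> [/\ k <= M &
  (k <= 12) || (if hooked then (k == 3 * l + 6) || (3 * l + 8 <= k)
                else 3 * l + 7 <= k)].
Proof.
have /and5P[_ _ _ /allP gok _] := gC.
move=> /mapP[[b a] /gok/andP[/= a12 a11] ->]; rewrite /place /M /=.
case: b a11; case: hooked => /= a11; clear -l13 a12 a11; try by split; lia.
by have {a11} : a != 11 by []; split; lia.
Qed.

Lemma gadget_tail_uniq : uniq (lab ++ unpair qs).
Proof.
have /and5P[_ ug _ _ _] := gC.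
rewrite cat_uniq map_inj_in_uniq ?ug; last exact: place_inj.
have -> : uniq (unpair qs).
  rewrite -map_unpair map_inj_uniq ?langford_pairs_uniq.1 // => x y.
  exact: addIn.
rewrite andbT; apply/hasPn => k /tail_range[k12 _ kt]; apply/negP => /gadget_range[_].
by clear -k12 kt; move: kt; case: hooked; lia.
Qed.

Lemma gadget_tail_le : {in lab ++ unpair qs, forall k, k <= M}.
Proof. by move=> k; rewrite mem_cat => /orP[/gadget_range[]|/tail_range[]]. Qed.

Lemma gadget_labels m : m \in mark_target hooked ->
  place M m \in labels_of (label_triangles c lab qs).
Proof.
have /and5P[/eqP sg _ _ /allP gok /allP gsub] := gC; rewrite c6 in sg.
have labE j : j < 13 -> nth 0 lab j = place M (nth (lo 0) g j).
  by move=> Hj; rewrite (nth_map (lo 0)) // sg.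
move=> /gsub /mapP[[u v] uv ->].
rewrite /labels_of /label_triangles sides_cat map_cat mem_cat -map_sides -map_comp.
apply/orP; left; apply/mapP; exists (u, v) => //=.
have [u13 v13] : u < 13 /\ v < 13.
  case/flatten_mapP: uv => t tc; have := wf_code_bound wf tc; rewrite c6 => -[? ? ?].
  by rewrite /tri_sides !inE => /or3P[] /eqP[-> ->].
have g12 j : j < 13 -> (nth (lo 0) g j).2 <= 12.
  by move=> Hj; have /andP[] := gok _ (mem_nth (lo 0) (eq_ind_r (leq j.+1) Hj sg)).
rewrite !labE // place_dist ?g12 //; clear -l13; rewrite /M; case: hooked; lia.
Qed.

Lemma tail_labels k :
  (k \in unpair qs) || (k \in [seq dist p.1 p.2 | p <- ps]) ->
  k \in labels_of (label_triangles c lab qs).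
Proof.
have /and5P[/eqP sg _ /eqP g0 _ _] := gC.
have lab0 : nth 0 lab 0 = 0 by rewrite /lab; case: (g) g0 sg => //= a s ->.
rewrite /labels_of /label_triangles sides_cat map_cat mem_cat lab0 => kq.
apply/orP; right; rewrite /qs; case/orP: kq.
  rewrite mem_unpair /qs => /hasP[[a b] abq kab]; apply/mapP.
  exists (0, k); last by rewrite /dist /= sub0n subn0.
  apply/flatten_mapP; exists (0, a, b); first by apply/mapP; exists (a, b).
  by case/orP: kab => /= /eqP->; rewrite !inE eqxx ?orbT.
case/mapP=> -[a b] abp ->; apply/mapP; exists (shift a, shift b).
  apply/flatten_mapP; exists (0, shift a, shift b); last by rewrite !inE eqxx ?orbT.
  by rewrite -map_comp; apply/mapP; exists (a, b).
by rewrite /dist /shift /= !subnDr.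
Qed.

(** In increasing order: differences inside the gadget, distances of the tail,
positions of the tail, and sides of the gadget that join a small label to a
large one. *)
Lemma gadget_tail_cover k : 0 < k ->
  (if hooked then k <= 3 * l + 18 else (k <= 3 * l + 17) || (k == 3 * l + 19)) ->
  k \in labels_of (label_triangles c lab qs).
Proof.
move=> k0 kM; have [k6|k6] := leqP k 6.
  rewrite -[k]/(place M (lo k)); apply: gadget_labels.
  by rewrite mem_cat map_f // mem_iota k0.
have [kl|kl] := ltnP k (7 + l).
  have [_ _ dif] := psL.
  by apply/tail_labels/orP; right; apply: dif; rewrite mem_iota k6.
have [kq|kq] := boolP (k \in unpair qs); first by rewrite tail_labels ?kq.
have kpos : k - (l + 6) \notin langford_positions l hooked.
  apply: contra kq; rewrite langford_pairs_uniq.2 -map_unpair => kp.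
  by apply/mapP; exists (k - (l + 6)); rewrite // /shift; clear -kl; lia.
have -> : k = place M (hi (M - k)).
  by rewrite /place /M /=; move: kM; clear; case: hooked; lia.
apply: gadget_labels; rewrite mem_cat map_f ?orbT //.
move: kpos kM; clear -kl; rewrite /langford_positions /M.
by case: hooked; rewrite ?mem_rcons ?in_cons !mem_iota; lia.
Qed.

End GadgetTail.

(** Here N = l + 6, so a tail that is hooked, l = 2, 3 mod 4, goes with
N = 0, 1 mod 4. *)
Lemma large_graceful (G : sgraph) (c : seq nat) n :
  c \in cactus_codes -> coded G c n -> 19 <= size c + n ->
  graceful G \/ near_graceful G.
Proof.
move=> /mem_cactus_codes[i iI ->] cG ge19.
have := allP gadgets_ok i iI; cbv zeta; set c' := nth _ _ _ in cG ge19 *.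
case/and5P => c6 /eqP p6 wf wfp gads.
have {cG ge19} [l l13 cG] : exists2 l, 13 <= l & coded G (pad_code c') l.
  exists (size c' + n - 6); first by lia.
  by apply: coded_absorbn => //; have -> : size c' + n - 6 + (6 - size c') = n by lia.
have [ps psL] := langford7 l13.
have [g gC] : exists g, gadget_check (pad_code c') (1 < l %% 4) g.
  by case: (1 < _); [exists (nth [::] graceful_gadgets i) | exists (nth [::] near_gadgets i)];
     case/andP: gads.
have hookE : ((6 + l) %% 4 < 2) = (1 < l %% 4) by clear; lia.
apply: (coded_graceful wfp cG _ _ (gadget_tail_uniq l13 gC psL)).
- by have /and5P[/eqP sg _ _ _ _] := gC; rewrite size_map.
- by have [sp _ _] := psL; rewrite size_map.
- move=> k /(gadget_tail_le l13 gC psL).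
  by rewrite p6 /top_label hookE; case: ifP => _; lia.
move=> k; rewrite p6 mem_target hookE => kt.
by apply: (gadget_tail_cover wfp p6 l13 gC psL); move: kt; clear;
  case: (1 < _); lia.
Qed.

Theorem theorem1p1 (W G : sgraph) (k : nat)
  (hW : dutch_windmill W) (hk : k <= 3) (hG : with_pendants W k G) :
  graceful G \/ near_graceful G.
Proof.
have [c cc [_ [n cG]]] := cactus_codes_complete hW hk hG.
have [le18|gt18] := leqP (size c + n) 18; first exact: small_graceful cc cG le18.
exact: large_graceful cc cG gt18.
Qed.
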